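(* Let $(R,\mathfrak{m})$ be a complete Noetherian local commutative ring of prime characteristic $p$ that is $F$-finite, let $E := E_R(R/\mathfrak{m})$ be the injective envelope of the simple $R$-module, and fix an $(R,R)$-bimodule isomorphism $\Psi : {}_fE \to \operatorname{Hom}_{rR}(R_f,E)$. Let $\mathbf{D}$ and $\mathbf{D}'$ be the contravariant functors described in the context (formed with $I = E$). (i) $\mathbf{D}$ and $\mathbf{D}'$ are inverse (contravariant) equivalences between the category of left $R[x,f]$-modules that are Artinian as $R$-modules and the category of right $R[x,f]$-modules that are Noetherian as $R$-modules. (ii) $\mathbf{D}$ and $\mathbf{D}'$ are inverse (contravariant) equivalences between the category of right $R[x,f]$-modules that are Artinian as $R$-modules and the category of left $R[x,f]$-modules that are Noetherian as $R$-modules. (In each category the morphisms are all $R[x,f]$-homomorphisms.)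
   Context: $f : R \to R$, $f(r)=r^p$, is the Frobenius homomorphism; $R$ is $F$-finite if $f$ is a finite ring homomorphism. The Frobenius skew polynomial ring $R[x,f]$ is freely generated as a left $R$-module by $(x^i)_{i\ge 0}$, with multiplication subject to $xr = r^p x$ for $r\in R$. Left and right $R[x,f]$-modules are regarded as $R$-modules by restriction of scalars; since $R$ is commutative, $R$-modules are regarded as both left and right $R$-modules. Bimodules, for an $R$-module $I$: $R_f$ is $R$ as an Abelian group with $r\cdot m\cdot s = r s^p m$; ${}_fI$ is $I$ as an Abelian group with $r\cdot z\cdot s = r^p s z$. $\operatorname{Hom}_{rR}(R_f,I)$ is the group of right $R$-homomorphisms $R_f\to I$ (additive $\psi$ with $\psi(rs^p)=\psi(r)s$), an $(R,R)$-bimodule via $(s\psi s')(r) = s\,\psi(s'r)$. An isomorphism $\Psi$ as in the claim exists when $R$ is $F$-finite and $I$ is injective. It makes $I$ a right $R[x,f]$-module via $zx = (\Psi(z))(1)$ for $z\in I$. Write $G^\vee = \operatorname{Hom}_R(G,I)$ for an $R$-module $G$. The contravariant functor $\mathbf{D}$ from left $R[x,f]$-modules to right $R[x,f]$-modules sends a left $R[x,f]$-module $H$ to $H^\vee$ with its usual $R$-module structure and right action of $x$ given by $(mx)(h) = (\Psi(m(xh)))(1)$ for $m\in H^\vee$, $h \in H$. The contravariant functor $\mathbf{D}'$ from right $R[x,f]$-modules to left $R[x,f]$-modules sends a right $R[x,f]$-module $M$ to $M^\vee$ with its usual $R$-module structure and left action of $x$ given by $(xh)(m) = \Psi^{-1}\big(r'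 \mapsto h((mr')x)\big)$ for $h\in M^\vee$, $m\in M$. On morphisms, $\mathbf{D}(\varphi)=\varphi^\vee$ and $\mathbf{D}'(\psi)=\psi^\vee$. *)

(* Defs.v *)
From HB Require Import structures.
From mathcomp Require Import all_boot all_algebra.
From mathcomp Require Import boolp.

Set Implicit Arguments.
Unset Strict Implicit.
Unset Printing Implicit Defensive.

Import GRing.Theory.
Local Open Scope ring_scope.

Record category := Category {
  obj :> Type;
  mor : obj -> obj -> Type;
  idm : forall X, mor X X;
  compm : forall X Y Z, mor Y Z -> mor X Y -> mor X Z;
  compm1 : forall X Y (f : mor X Y), compm f (idm X) = f;
  comp1m : forall X Y (f : mor X Y), compm (idm Y) f = f;
  compmA : forall X Y Z W (f : mor Z W) (g : mor Y Z) (h : mor X Y),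
    compm f (compm g h) = compm (compm f g) h }.

Arguments idm {_} X.

Record cofunctor (C D : category) := Cofunctor {
  coobj :> C -> D;
  comap : forall X Y : C, mor X Y -> mor (coobj Y) (coobj X);
  comap1 : forall X : C, comap (idm X) = idm (coobj X);
  comapM : forall (X Y Z : C) (f : mor Y Z) (g : mor X Y),
    comap (compm f g) = compm (comap g) (comap f) }.

Definition isom (C : category) (X Y : C) (f : mor X Y) : Prop :=
  exists g : mor Y X, compm g f = idm X /\ compm f g = idm Y.

(* the composite functor X |-> G (F X) is naturally isomorphic to the identity *)
Definition comp_iso_id (C D : category) (F : cofunctor C D) (G : cofunctor D C) :=
  exists eta : forall X : C, mor X (G (F X)),
    (forall X, isom (eta X)) /\
    (forall (X Y : C) (f : mor X Y),
       compm (eta Y) f = compm (comap G (comap F f)) (eta X)).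

Definition inverse_dualities (C D : category)
    (F : cofunctor C D) (G : cofunctor D C) : Prop :=
  comp_iso_id F G /\ comp_iso_id G F.

Definition full_subcategory (C : category) (P : C -> Prop) : category :=
  @Category {X : C | P X} (fun X Y => mor (sval X) (sval Y))
    (fun X => idm (sval X)) (fun _ _ _ f g => compm f g)
    (fun _ _ f => compm1 f) (fun _ _ f => comp1m f)
    (fun _ _ _ _ f g h => compmA f g h).

Definition cofunctor_restr (C D : category) (P : C -> Prop) (Q : D -> Prop)
    (F : cofunctor C D) (PQ : forall X : C, P X -> Q (F X)) :
    cofunctor (full_subcategory P) (full_subcategory Q) :=
  @Cofunctor (full_subcategory P) (full_subcategory Q)
    (fun X => exist _ (F (sval X)) (PQ _ (svalP X)))
    (fun _ _ f => comap F f)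
    (fun X => comap1 F (sval X)) (fun _ _ _ f g => comapM F f g).

Definition inverse_dualities_on (C D : category) (P : C -> Prop) (Q : D -> Prop)
    (F : cofunctor C D) (G : cofunctor D C) : Prop :=
  exists (PQ : forall X, P X -> Q (F X)) (QP : forall Y, Q Y -> P (G Y)),
    inverse_dualities (cofunctor_restr PQ) (cofunctor_restr QP).

Lemma linear_ext (R : pzRingType) (U V : lmodType R) (f g : {linear U -> V}) :
  f =1 g -> f = g.
Proof.
case: f g => [f [[f1] [f2]]] [g [[g1] [g2]]] /= /funext efg.
by subst g; rewrite (Prop_irrelevance f1 g1) (Prop_irrelevance f2 g2).
Qed.

HB.instance Definition _ (R : pzRingType) (U V : lmodType R) :=
  gen_eqMixin {linear U -> V}.
HB.instance Definition _ (R : pzRingType) (U V : lmodType R) :=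
  gen_choiceMixin {linear U -> V}.

Section HomModule.
Variables (R : comPzRingType) (U V : lmodType R).
Implicit Types f g : {linear U -> V}.

Definition hom_zero : {linear U -> V} := \0.
Definition hom_opp f : {linear U -> V} := \- f.
Definition hom_add f g : {linear U -> V} := f \+ g.
Definition hom_scale (a : R) f : {linear U -> V} := a \*: f.

Fact hom_addA : associative hom_add.
Proof. by move=> f g h; apply: linear_ext => x /=; rewrite addrA. Qed.
Fact hom_addC : commutative hom_add.
Proof. by move=> f g; apply: linear_ext => x /=; rewrite addrC. Qed.
Fact hom_add0 : left_id hom_zero hom_add.
Proof. by move=> f; apply: linear_ext => x /=; rewrite add0r. Qed.
Fact hom_addN : left_inverse hom_zero hom_opp hom_add.
Proof. by move=> f; apply: linear_ext => x /=; rewrite addNr. Qed.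

HB.instance Definition _ :=
  GRing.isZmodule.Build {linear U -> V} hom_addA hom_addC hom_add0 hom_addN.

Fact hom_scaleA a b f : hom_scale a (hom_scale b f) = hom_scale (a * b) f.
Proof. by apply: linear_ext => x /=; rewrite scalerA. Qed.
Fact hom_scale1 : left_id 1 hom_scale.
Proof. by move=> f; apply: linear_ext => x /=; rewrite scale1r. Qed.
Fact hom_scaleDr : right_distributive hom_scale +%R.
Proof. by move=> a f g; apply: linear_ext => x /=; rewrite scalerDr. Qed.
Fact hom_scaleDl f : {morph hom_scale^~ f : a b / a + b}.
Proof. by move=> a b; apply: linear_ext => x /=; rewrite scalerDl. Qed.

HB.instance Definition _ := GRing.Zmodule_isLmodule.Build R {linear U -> V}
  hom_scaleA hom_scale1 hom_scaleDr hom_scaleDl.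

Lemma homDE f g x : (f + g) x = f x + g x. Proof. by []. Qed.
Lemma homZE a f x : (a *: f) x = a *: f x. Proof. by []. Qed.
End HomModule.

Section ModuleCategory.
Variable S : pzRingType.

Definition mod_id (U : lmodType S) : {linear U -> U} := idfun.
Definition mod_comp (U V W : lmodType S) (f : {linear V -> W})
  (g : {linear U -> V}) : {linear U -> W} := f \o g.

Fact mod_comp1 (U V : lmodType S) (f : {linear U -> V}) : mod_comp f (mod_id U) = f.
Proof. exact: linear_ext. Qed.
Fact mod_1comp (U V : lmodType S) (f : {linear U -> V}) : mod_comp (mod_id V) f = f.
Proof. exact: linear_ext. Qed.
Fact mod_compA (U V W X : lmodType S) (f : {linear W -> X}) (g : {linear V -> W})
  (h : {linear U -> V}) : mod_comp f (mod_comp g h) = mod_comp (mod_comp f g) h.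
Proof. exact: linear_ext. Qed.

Definition module_category : category :=
  @Category (lmodType S) (fun U V => {linear U -> V}) mod_id mod_comp
    mod_comp1 mod_1comp mod_compA.
End ModuleCategory.

(* right S-modules are left modules over the converse ring *)
Notation right_module_category S := (module_category S^c).

Definition rscale (S : pzRingType) (M : lmodType S^c) (u : M) (s : S) : M :=
  (s : S^c) *: u.

Definition restr (R S : pzRingType) (phi : {rmorphism R -> S}) (V : lmodType S)
  : Type := V.

Section Restriction.
Variables (R S : pzRingType) (phi : {rmorphism R -> S}).
Local Notation restr := (restr phi).

Section Instances.
Variable V : lmodType S.
HB.instance Definition _ := GRing.Zmodule.copy (restr V) V.
Definition restr_scale (r : R) (v : restr V) : restr V := phi r *: (v : V).
Fact restr_scaleA a b v :
  restr_scale a (restr_scale b v) = restr_scale (a * b) v.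
Proof. by rewrite /restr_scale scalerA rmorphM. Qed.
Fact restr_scale1 : left_id 1 restr_scale.
Proof. by move=> v; rewrite /restr_scale rmorph1 scale1r. Qed.
Fact restr_scaleDr : right_distributive restr_scale +%R.
Proof. by move=> a u v; rewrite /restr_scale scalerDr. Qed.
Fact restr_scaleDl v : {morph restr_scale^~ v : a b / a + b}.
Proof. by move=> a b; rewrite /restr_scale rmorphD scalerDl. Qed.
HB.instance Definition _ := GRing.Zmodule_isLmodule.Build R (restr V)
  restr_scaleA restr_scale1 restr_scaleDr restr_scaleDl.

Lemma restrZE r (v : V) : r *: (v : restr V) = phi r *: v. Proof. by []. Qed.
End Instances.

Section Map.
Variables (V W : lmodType S) (f : {linear V -> W}).
Definition restr_fun : restr V -> restr W := f.
Fact restr_fun_linear : linear restr_fun.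
Proof. by move=> r u v; rewrite /restr_fun linearP. Qed.
HB.instance Definition _ :=
  GRing.isLinear.Build R (restr V) (restr W) *:%R restr_fun restr_fun_linear.
Definition restr_map : {linear restr V -> restr W} := restr_fun.
End Map.

End Restriction.

Section Operators.
Variable R : comNzRingType.
Implicit Types P Q : {poly R}.

Section Left.
Variables (V : lmodType R) (tau : {additive V -> V}).

(* sum_i a_i x^i acts as sum_i a_i tau^i *)
Definition lop (P : {poly R}) (v : V) : V :=
  \sum_(i < size P) P`_i *: iter i tau v.

Lemma lop_wide n P v : (size P <= n)%N ->
  lop P v = \sum_(i < n) P`_i *: iter i tau v.
Proof.
move=> le_n; rewrite /lop (big_ord_widen n (fun i => P`_i *: iter i tau v)) //.
rewrite big_mkcond; apply: eq_bigr => i _; case: ltnP => // le_i.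
by rewrite nth_default ?scale0r.
Qed.

Lemma lopDl v : {morph lop^~ v : P Q / P + Q}.
Proof.
move=> P Q; set n := maxn (size P) (size Q).
rewrite !(@lop_wide n) ?leq_maxl ?leq_maxr ?size_polyD // -big_split.
by apply: eq_bigr => i _; rewrite coefD scalerDl.
Qed.

Lemma lop0 v : lop 0 v = 0.
Proof. by rewrite /lop size_poly0 big_ord0. Qed.

Lemma lop_iterD i : {morph iter i tau : u v / u + v}.
Proof. by elim: i => // i IH u v; rewrite !iterS IH raddfD. Qed.

Lemma lopDr P : {morph lop P : u v / u + v}.
Proof.
move=> u v; rewrite /lop -big_split; apply: eq_bigr => i _.
by rewrite lop_iterD scalerDr.
Qed.

Lemma lopZ a P v : lop (a *: P) v = a *: lop P v.
Proof.
rewrite (@lop_wide (size P)) ?size_scale_leq // scaler_sumr.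
by apply: eq_bigr => i _; rewrite coefZ scalerA.
Qed.

Lemma lopC a v : lop a%:P v = a *: v.
Proof. by rewrite (@lop_wide 1) ?size_polyC_leq1 // big_ord1 coefC. Qed.

Lemma lopX v : lop 'X v = tau v.
Proof.
by rewrite /lop size_polyX big_ord_recl big_ord1 !coefX /= scale0r add0r scale1r.
Qed.
End Left.

Section Right.
Variables (V : lmodType R) (tau : {additive V -> V}).

(* on the right, sum_i a_i x^i acts as v |-> sum_i tau^i (a_i v) *)
Definition rop (P : {poly R}) (v : V) : V :=
  \sum_(i < size P) iter i tau (P`_i *: v).

Lemma iter_additive0 i : iter i tau 0 = 0.
Proof. by elim: i => // i IH; rewrite iterS IH raddf0. Qed.

Lemma rop_wide n P v : (size P <= n)%N ->
  rop P v = \sum_(i < n) iter i tau (P`_i *: v).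
Proof.
move=> le_n; rewrite /rop (big_ord_widen n (fun i => iter i tau (P`_i *: v))) //.
rewrite big_mkcond; apply: eq_bigr => i _; case: ltnP => // le_i.
by rewrite nth_default // scale0r iter_additive0.
Qed.

Lemma ropDl v : {morph rop^~ v : P Q / P + Q}.
Proof.
move=> P Q; set n := maxn (size P) (size Q).
rewrite !(@rop_wide n) ?leq_maxl ?leq_maxr ?size_polyD // -big_split.
by apply: eq_bigr => i _; rewrite coefD scalerDl lop_iterD.
Qed.

Lemma rop0 v : rop 0 v = 0.
Proof. by rewrite /rop size_poly0 big_ord0. Qed.

Lemma ropDr P : {morph rop P : u v / u + v}.
Proof.
move=> u v; rewrite /rop -big_split; apply: eq_bigr => i _.
by rewrite scalerDr lop_iterD.
Qed.

Lemma ropZ a P v : rop (a *: P) v = rop P (a *: v).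
Proof.
rewrite (@rop_wide (size P)) ?size_scale_leq //.
by apply: eq_bigr => i _; rewrite coefZ scalerA mulrC.
Qed.

Lemma ropC a v : rop a%:P v = a *: v.
Proof. by rewrite (@rop_wide 1) ?size_polyC_leq1 // big_ord1 coefC. Qed.

Lemma ropX v : rop 'X v = tau v.
Proof.
rewrite /rop size_polyX big_ord_recl big_ord1 !coefX /= scale0r scale1r.
by rewrite add0r.
Qed.
End Right.
End Operators.

(* {poly R} as a left R-module, with multiplication twisted by x r = sigma(r) x;
   sigma is a parameter so that it can be inferred from the type *)
Definition skewpoly (R : comNzRingType) (sigma : {rmorphism R -> R}) : Type :=
  {poly R}.

Section SkewPolynomial.
Variables (R : comNzRingType) (sigma : {rmorphism R -> R}).
Implicit Types P Q : {poly R}.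
Local Notation skewpoly := (skewpoly sigma).

HB.instance Definition _ := GRing.Zmodule.copy skewpoly {poly R}.

(* left multiplication by x : sum_j b_j x^j |-> sum_j sigma(b_j) x^(j+1) *)
Definition skew_shift (Q : {poly R}) : {poly R} := map_poly sigma Q * 'X.
Fact skew_shift_additive : zmod_morphism skew_shift.
Proof. by move=> P Q; rewrite /skew_shift rmorphB mulrBl. Qed.
HB.instance Definition _ := GRing.isZmodMorphism.Build {poly R} {poly R}
  skew_shift skew_shift_additive.

Definition skew_mul (P Q : skewpoly) : skewpoly := lop skew_shift P Q.

Lemma skew_shiftZ a Q : skew_shift (a *: Q) = sigma a *: skew_shift Q.
Proof. by rewrite /skew_shift map_polyZ scalerAl. Qed.

Lemma size_skew_shift Q : (size (skew_shift Q) <= (size Q).+1)%N.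
Proof.
rewrite /skew_shift; apply: leq_trans (size_polyMleq _ _) _.
by rewrite size_polyX addn2 /= ltnS size_poly.
Qed.

Section LeftAction.
Variables (V : lmodType R) (tau : {additive V -> V}).
Hypothesis tauZ : forall r v, tau (r *: v) = sigma r *: tau v.

Lemma lop_shift Q v : lop tau (skew_shift Q) v = tau (lop tau Q v).
Proof.
rewrite (lop_wide _ _ (size_skew_shift Q)) big_ord_recl.
rewrite coefMX /= scale0r add0r raddf_sum; apply: eq_bigr => i _.
by rewrite coefMX /= coef_map tauZ.
Qed.

Lemma lopM P Q v : lop tau (skew_mul P Q) v = lop tau P (lop tau Q v).
Proof.
rewrite /skew_mul [lop _ P Q]/lop (big_morph (lop tau ^~ v) (lopDl tau v) (lop0 tau v)).
rewrite [RHS]/lop; apply: eq_bigr => i _; rewrite lopZ; congr (_ *: _).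
by elim: (i : nat) => // j IH; rewrite !iterS lop_shift IH.
Qed.
End LeftAction.

Section RightAction.
Variables (V : lmodType R) (tau : {additive V -> V}).
Hypothesis tauZ : forall r v, tau (sigma r *: v) = r *: tau v.

Lemma rop_shift Q v : rop tau (skew_shift Q) v = rop tau Q (tau v).
Proof.
rewrite (rop_wide _ _ (size_skew_shift Q)) big_ord_recl.
rewrite coefMX /= scale0r add0r; apply: eq_bigr => i _.
by rewrite coefMX -iterS iterSr coef_map tauZ.
Qed.

Lemma ropM P Q v : rop tau (skew_mul P Q) v = rop tau Q (rop tau P v).
Proof.
rewrite /skew_mul /lop (big_morph (rop tau ^~ v) (ropDl tau v) (rop0 tau v)).
have rQ0 : rop tau Q 0 = 0.
  by rewrite /rop big1 // => i _; rewrite scaler0 iter_additive0.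
rewrite [rop tau P v]/rop (big_morph _ (ropDr tau Q) rQ0).
apply: eq_bigr => i _; rewrite ropZ.
by elim: (i : nat) (_ *: v) => // j IH u; rewrite !iterS rop_shift IH -iterSr.
Qed.
End RightAction.

Fact skew_mulA : associative skew_mul.
Proof. by move=> P Q T; apply: esym (lopM skew_shiftZ P Q T). Qed.
Fact skew_mul1l : left_id (1 : {poly R}) skew_mul.
Proof. by move=> P; rewrite /skew_mul -[1]/(1%:P) lopC scale1r. Qed.
Fact skew_mul1r : right_id (1 : {poly R}) skew_mul.
Proof.
move=> P; rewrite /skew_mul /lop -[RHS]coefK poly_def; apply: eq_bigr => i _.
congr (_ *: _); elim: (i : nat) => // j IH.
by rewrite iterS IH /= /skew_shift map_polyXn -exprSr.
Qed.
Fact skew_mulDl : left_distributive skew_mul +%R.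
Proof. by move=> P Q T; apply: lopDl. Qed.
Fact skew_mulDr : right_distributive skew_mul +%R.
Proof. by move=> P Q T; apply: lopDr. Qed.
Fact skew_1neq0 : (1 : {poly R}) != 0. Proof. exact: oner_neq0. Qed.

HB.instance Definition _ := GRing.Zmodule_isNzRing.Build skewpoly
  skew_mulA skew_mul1l skew_mul1r skew_mulDl skew_mulDr skew_1neq0.

Definition skewX : skewpoly := 'X.
Definition skewC (r : R) : skewpoly := r%:P.
Definition skewCc (r : R) : skewpoly^c := skewC r.

Fact skewC_zmod : zmod_morphism skewC.
Proof. by move=> a b; rewrite /skewC polyCB. Qed.
Fact skewC_mul : monoid_morphism skewC.
Proof.
by split=> // a b; rewrite -[RHS]/(lop _ _ _) lopC -mul_polyC -polyCM.
Qed.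
HB.instance Definition _ :=
  GRing.isZmodMorphism.Build R skewpoly skewC skewC_zmod.
HB.instance Definition _ :=
  GRing.isMonoidMorphism.Build R skewpoly skewC skewC_mul.

Fact skewCc_mul : monoid_morphism skewCc.
Proof. by split=> // a b; rewrite mulrC /skewCc rmorphM. Qed.
HB.instance Definition _ :=
  GRing.isZmodMorphism.Build R skewpoly^c skewCc skewC_zmod.
HB.instance Definition _ :=
  GRing.isMonoidMorphism.Build R skewpoly^c skewCc skewCc_mul.

Lemma skewXC r : skewX * skewC r = skewC (sigma r) * skewX.
Proof.
rewrite -[LHS]/(lop _ _ _) -[RHS]/(lop _ _ _) lopX lopC.
by rewrite /= /skew_shift map_polyC mul_polyC.
Qed.

(* the powers of x form a basis of R[x, sigma] as a left R-module *)
Lemma skewpolyE (P : skewpoly) :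
  P = \sum_(i < size (P : {poly R})) skewC (P : {poly R})`_i * skewX ^+ i.
Proof.
have sX i : skewX ^+ i = 'X^i :> {poly R}.
  elim: i => // i IH.
  by rewrite exprS -[LHS]/(lop _ _ _) lopX IH /= /skew_shift map_polyXn -exprSr.
rewrite -[LHS](coefK (P : {poly R})) poly_def; apply: eq_bigr => i _.
by rewrite -[RHS]/(lop _ _ _) lopC sX.
Qed.

Definition left_restr (H : lmodType skewpoly) : lmodType R := restr skewC H.
Definition right_restr (M : lmodType skewpoly^c) : lmodType R := restr skewCc M.

End SkewPolynomial.

Section OperatorMorphisms.
Variables (R : comNzRingType) (V W : lmodType R).
Variables (tau : {additive V -> V}) (tau' : {additive W -> W}).
Variables (g : {linear V -> W}) (gtau : forall v, g (tau v) = tau' (g v)).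

Lemma iter_morph i v : g (iter i tau v) = iter i tau' (g v).
Proof. by elim: i => // i IH; rewrite !iterS gtau IH. Qed.

Lemma lop_morph (P : {poly R}) v : g (lop tau P v) = lop tau' P (g v).
Proof.
rewrite /lop raddf_sum; apply: eq_bigr => i _.
by rewrite /= linearZ /= iter_morph.
Qed.

Lemma rop_morph (P : {poly R}) v : g (rop tau P v) = rop tau' P (g v).
Proof.
rewrite /rop raddf_sum; apply: eq_bigr => i _.
by rewrite /= iter_morph linearZ.
Qed.
End OperatorMorphisms.

Record bimodule (R : pzRingType) := Bimodule {
  bicar :> zmodType;
  lact : R -> bicar -> bicar;
  ract : bicar -> R -> bicar;
  lactA : forall r s m, lact r (lact s m) = lact (r * s) m;
  lact1 : forall m, lact 1 m = m;
  lactDr : forall r, {morph lact r : m n / m + n};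
  lactDl : forall m, {morph lact^~ m : r s / r + s};
  ractA : forall m r s, ract (ract m r) s = ract m (r * s);
  ract1 : forall m, ract m 1 = m;
  ractDl : forall r, {morph ract^~ r : m n / m + n};
  ractDr : forall m, {morph ract m : r s / r + s};
  lract : forall r m s, ract (lact r m) s = lact r (ract m s) }.

Record bimodule_iso (R : pzRingType) (M N : bimodule R) := BimoduleIso {
  biso :> M -> N;
  bisoV : N -> M;
  bisoK : cancel biso bisoV;
  bisoVK : cancel bisoV biso;
  bisoD : {morph biso : m n / m + n};
  bisoL : forall r m, biso (lact r m) = lact r (biso m);
  bisoR : forall m r, biso (ract m r) = ract (biso m) r }.

Lemma bisoVD (R : pzRingType) (M N : bimodule R) (f : bimodule_iso M N) :
  {morph bisoV f : m n / m + n}.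
Proof. by move=> m n; apply: (can_inj (bisoK f)); rewrite bisoD !bisoVK. Qed.

Lemma bisoVL (R : pzRingType) (M N : bimodule R) (f : bimodule_iso M N) r n :
  bisoV f (lact r n) = lact r (bisoV f n).
Proof. by apply: (can_inj (bisoK f)); rewrite bisoL !bisoVK. Qed.

Lemma bisoVR (R : pzRingType) (M N : bimodule R) (f : bimodule_iso M N) n r :
  bisoV f (ract n r) = ract (bisoV f n) r.
Proof. by apply: (can_inj (bisoK f)); rewrite bisoR !bisoVK. Qed.

Section Bimodules.
Variables (R : comNzRingType) (sigma : {rmorphism R -> R}).

(* R_f : r . m . s = r s^p m *)
Program Definition right_twist : bimodule R :=
  @Bimodule R R (fun r m => r * m) (fun m s => sigma s * m)
    _ _ _ _ _ _ _ _ _.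
Next Obligation. by rewrite mulrA. Qed.
Next Obligation. by rewrite mul1r. Qed.
Next Obligation. by move=> m n; rewrite mulrDr. Qed.
Next Obligation. by move=> r s; rewrite mulrDl. Qed.
Next Obligation. by rewrite mulrA -rmorphM mulrC [s * r]mulrC mulrC. Qed.
Next Obligation. by rewrite rmorph1 mul1r. Qed.
Next Obligation. by move=> m n; rewrite mulrDr. Qed.
Next Obligation. by move=> r s; rewrite rmorphD mulrDl. Qed.
Next Obligation. by rewrite mulrCA. Qed.

(* _f I : r . z . s = r^p s z *)
Program Definition left_twist (I : lmodType R) : bimodule R :=
  @Bimodule R I (fun r z => sigma r *: z) (fun z s => s *: z)
    _ _ _ _ _ _ _ _ _.
Next Obligation. by rewrite scalerA rmorphM. Qed.
Next Obligation. by rewrite rmorph1 scale1r. Qed.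
Next Obligation. by move=> m n; rewrite scalerDr. Qed.
Next Obligation. by move=> r s; rewrite rmorphD scalerDl. Qed.
Next Obligation. by rewrite scalerA mulrC. Qed.
Next Obligation. by rewrite scale1r. Qed.
Next Obligation. by move=> m n; rewrite scalerDr. Qed.
Next Obligation. by move=> r s; rewrite scalerDl. Qed.
Next Obligation. by rewrite !scalerA mulrC. Qed.
End Bimodules.

(* right R-homomorphisms from a bimodule to an R-module *)
Record rhom (R : pzRingType) (M : bimodule R) (I : lmodType R) := Rhom {
  rhom_fun :> M -> I;
  rhomD : {morph rhom_fun : u v / u + v};
  rhomR : forall u s, rhom_fun (ract u s) = s *: rhom_fun u }.

Section RightHom.
Variables (R : comPzRingType) (M : bimodule R) (I : lmodType R).
Implicit Types f g h : rhom M I.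

Lemma rhom_ext f g : f =1 g -> f = g.
Proof.
case: f g => [f f1 f2] [g g1 g2] /= /funext efg.
by subst g; rewrite (Prop_irrelevance f1 g1) (Prop_irrelevance f2 g2).
Qed.

HB.instance Definition _ := gen_eqMixin (rhom M I).
HB.instance Definition _ := gen_choiceMixin (rhom M I).

Program Definition rhom_zero : rhom M I := @Rhom R M I (fun=> 0) _ _.
Next Obligation. by move=> u v; rewrite addr0. Qed.
Next Obligation. by rewrite scaler0. Qed.
Program Definition rhom_add f g : rhom M I :=
  @Rhom R M I (fun u => f u + g u) _ _.
Next Obligation. by move=> u v; rewrite !rhomD addrACA. Qed.
Next Obligation. by rewrite !rhomR scalerDr. Qed.
Program Definition rhom_opp f : rhom M I := @Rhom R M I (fun u => - f u) _ _.
Next Obligation. by move=> u v; rewrite rhomD opprD. Qed.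
Next Obligation. by rewrite rhomR scalerN. Qed.

Fact rhom_addA : associative rhom_add.
Proof. by move=> f g h; apply: rhom_ext => u /=; rewrite addrA. Qed.
Fact rhom_addC : commutative rhom_add.
Proof. by move=> f g; apply: rhom_ext => u /=; rewrite addrC. Qed.
Fact rhom_add0 : left_id rhom_zero rhom_add.
Proof. by move=> f; apply: rhom_ext => u /=; rewrite add0r. Qed.
Fact rhom_addN : left_inverse rhom_zero rhom_opp rhom_add.
Proof. by move=> f; apply: rhom_ext => u /=; rewrite addNr. Qed.
HB.instance Definition _ :=
  GRing.isZmodule.Build (rhom M I) rhom_addA rhom_addC rhom_add0 rhom_addN.

Program Definition rhom_lact (s : R) f : rhom M I :=
  @Rhom R M I (fun u => s *: f u) _ _.
Next Obligation. by move=> u v; rewrite rhomD scalerDr. Qed.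
Next Obligation. by rewrite rhomR !scalerA mulrC. Qed.
Program Definition rhom_ract f (s : R) : rhom M I :=
  @Rhom R M I (fun u => f (lact s u)) _ _.
Next Obligation. by move=> u v; rewrite lactDr rhomD. Qed.
Next Obligation. by rewrite -lract rhomR. Qed.

(* Hom_{rR}(M, I) : (s psi s')(u) = s psi(s' u) *)
Program Definition rhom_bimodule : bimodule R :=
  @Bimodule R (rhom M I) rhom_lact rhom_ract _ _ _ _ _ _ _ _ _.
Next Obligation. by apply: rhom_ext => u /=; rewrite scalerA. Qed.
Next Obligation. by apply: rhom_ext => u /=; rewrite scale1r. Qed.
Next Obligation. by move=> f g; apply: rhom_ext => u /=; rewrite scalerDr. Qed.
Next Obligation. by move=> a b; apply: rhom_ext => u /=; rewrite scalerDl. Qed.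
Next Obligation. by apply: rhom_ext => u /=; rewrite lactA. Qed.
Next Obligation. by apply: rhom_ext => u /=; rewrite lact1. Qed.
Next Obligation. by move=> f g; apply: rhom_ext. Qed.
Next Obligation. by move=> a b; apply: rhom_ext => u /=; rewrite lactDl rhomD. Qed.
Next Obligation. by apply: rhom_ext. Qed.
End RightHom.

Notation frob_dual_iso sigma I :=
  (bimodule_iso (left_twist sigma I) (rhom_bimodule (right_twist sigma) I)).

Section DOperator.
Variables (R : comNzRingType) (sigma : {rmorphism R -> R}) (I : lmodType R).
Variable Psi : frob_dual_iso sigma I.
Variable H : lmodType (skewpoly sigma).
Implicit Types m : {linear left_restr H -> I}.

Lemma skew_scaleXC r (h : H) :
  skewX sigma *: (skewC sigma r *: h) = skewC sigma (sigma r) *: (skewX sigma *: h).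
Proof. by rewrite !scalerA skewXC. Qed.

Definition D_x_fun m (h : left_restr H) : I :=
  (Psi (m (skewX sigma *: (h : H)))) 1.

Fact D_x_linear m : linear (D_x_fun m).
Proof.
move=> r u v; rewrite /D_x_fun.
have -> : skewX sigma *: ((r *: u + v : left_restr H) : H) =
    sigma r *: (skewX sigma *: (u : H) : left_restr H) +
    (skewX sigma *: (v : H) : left_restr H) :> left_restr H.
  by rewrite scalerDr; congr (_ + _); apply: skew_scaleXC.
by rewrite linearP bisoD /= -[sigma r *: m _]/(lact r (_ : left_twist _ _)) bisoL.
Qed.
HB.instance Definition _ m :=
  GRing.isLinear.Build R (left_restr H) I *:%R (D_x_fun m) (D_x_linear m).

(* m |-> m x on Hom_R(H, I) *)
Definition D_x m : {linear left_restr H -> I} := D_x_fun m.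

Fact D_x_additive : zmod_morphism D_x.
Proof.
move=> m n; apply/eqP; rewrite eq_sym subr_eq; apply/eqP.
apply: linear_ext => h; rewrite homDE /= /D_x_fun.
set h' := skewX sigma *: _.
have {1}-> : m h' = (m - n) h' + n h' by rewrite -homDE subrK.
by rewrite bisoD.
Qed.
HB.instance Definition _ := GRing.isZmodMorphism.Build
  {linear left_restr H -> I} {linear left_restr H -> I} D_x D_x_additive.

Lemma D_xZ r m : D_x (sigma r *: m) = r *: D_x m.
Proof.
apply: linear_ext => h; rewrite homZE /= /D_x_fun homZE.
by rewrite -[sigma r *: m _]/(lact r (_ : left_twist _ _)) bisoL.
Qed.
End DOperator.

(* Hom_R(H, I), with the right action of x given by D_x; see D_actX and D_actC *)
Definition D_obj (R : comNzRingType) (sigma : {rmorphism R -> R})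
    (I : lmodType R) (Psi : frob_dual_iso sigma I)
    (H : lmodType (skewpoly sigma)) : Type :=
  {linear left_restr H -> I}.

Section DFunctor.
Variables (R : comNzRingType) (sigma : {rmorphism R -> R}) (I : lmodType R).
Variable Psi : frob_dual_iso sigma I.
Local Notation S := (skewpoly sigma).
Local Notation D_obj := (D_obj Psi).

Section Object.
Variable H : lmodType S.
HB.instance Definition _ := GRing.Zmodule.copy (D_obj H) {linear left_restr H -> I}.

Definition D_scale (P : S^c) (m : D_obj H) : D_obj H :=
  rop (D_x Psi (H := H)) P m.
Fact D_scaleA a b m : D_scale a (D_scale b m) = D_scale (a * b) m.
Proof. exact: esym (ropM (@D_xZ _ _ _ Psi H) _ _ _). Qed.
Fact D_scale1 : left_id 1 D_scale.
Proof. by move=> m; rewrite /D_scale ropC scale1r. Qed.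
Fact D_scaleDr : right_distributive D_scale +%R.
Proof. by move=> a m n; apply: ropDr. Qed.
Fact D_scaleDl m : {morph D_scale^~ m : a b / a + b}.
Proof. by move=> a b; apply: ropDl. Qed.
HB.instance Definition _ := GRing.Zmodule_isLmodule.Build S^c (D_obj H)
  D_scaleA D_scale1 D_scaleDr D_scaleDl.

Lemma D_actX (m : D_obj H) (h : H) :
  (rscale m (skewX sigma) : {linear left_restr H -> I}) h =
  Psi (m (skewX sigma *: h)) 1.
Proof. by rewrite -[rscale _ _]/(rop _ _ _) ropX. Qed.

Lemma D_actC (m : D_obj H) r :
  rscale m (skewC sigma r) = r *: (m : {linear left_restr H -> I}).
Proof. exact: ropC. Qed.
End Object.

Section Map.
Variables (H H' : lmodType S) (phi : {linear H -> H'}).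

Definition D_fun (m : D_obj H') : D_obj H :=
  ((m : {linear left_restr H' -> I}) \o restr_map (skewC sigma) phi
    : {linear left_restr H -> I}).

Let D_funR (m : {linear left_restr H' -> I}) : {linear left_restr H -> I} :=
  D_fun m.
Let D_funR_linear : linear D_funR.
Proof. by move=> r m n; apply: linear_ext. Qed.
HB.instance Definition _ := GRing.isLinear.Build R
  {linear left_restr H' -> I} {linear left_restr H -> I} *:%R D_funR D_funR_linear.

Fact D_fun_linear : linear D_fun.
Proof.
move=> P m n; rewrite -[LHS]/(D_funR (_ + _)) raddfD; congr (_ + _).
apply: (rop_morph (g := D_funR)) => {}m; apply: linear_ext => h.
by rewrite /= /D_x_fun /= /restr_fun linearZ.
Qed.
HB.instance Definition _ := GRing.isLinear.Build S^c (D_obj H') (D_obj H)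
  *:%R D_fun D_fun_linear.
Definition D_map : {linear D_obj H' -> D_obj H} := D_fun.
End Map.

Fact D_map1 (H : lmodType S) : D_map (mod_id H) = mod_id (D_obj H).
Proof. by apply: linear_ext => m; apply: linear_ext. Qed.
Fact D_mapM (X Y Z : lmodType S) (f : {linear Y -> Z}) (g : {linear X -> Y}) :
  D_map (mod_comp f g) = mod_comp (D_map g) (D_map f).
Proof. by apply: linear_ext => m; apply: linear_ext. Qed.

Definition D_functor :
    cofunctor (module_category S) (right_module_category S) :=
  @Cofunctor (module_category S) (right_module_category S)
    (fun H : lmodType S => D_obj H : lmodType S^c) D_map D_map1 D_mapM.
End DFunctor.

Section D'Operator.
Variables (R : comNzRingType) (sigma : {rmorphism R -> R}) (I : lmodType R).
Variable Psi : frob_dual_iso sigma I.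
Local Notation S := (skewpoly sigma).
Variable M : lmodType S^c.
Implicit Types h : {linear right_restr M -> I}.

Lemma rscaleA (u : M) (a b : S) : rscale (rscale u a) b = rscale u (a * b).
Proof. by rewrite /rscale scalerA. Qed.

(* r' |-> h ((u r') x) *)
Program Definition D'_aux h (u : M) : rhom (right_twist sigma) I :=
  @Rhom R (right_twist sigma) I
    (fun r' => h (rscale (rscale u (skewC sigma r')) (skewX sigma))) _ _.
Next Obligation.
move=> r s; rewrite -[RHS]raddfD; congr (h _).
by rewrite !rscaleA raddfD /= mulrDl /rscale scalerDl.
Qed.
Next Obligation.
rename u0 into r; rewrite -linearZ /=; congr (h _).
rewrite restrZE -/(rscale _ (skewC sigma s)) !rscaleA; congr (rscale u _).
by rewrite skewXC mulrA -rmorphM mulrC.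
Qed.

Definition D'_x_fun h (u : right_restr M) : I := bisoV Psi (D'_aux h u).

Fact D'_x_linear h : linear (D'_x_fun h).
Proof.
move=> r u v; rewrite /D'_x_fun.
have -> : D'_aux h (r *: u + v : right_restr M) =
    ract (D'_aux h u : rhom_bimodule _ _) r + D'_aux h v.
  apply: rhom_ext => t; rewrite /= -raddfD; congr (h _).
  rewrite rmorphM -!rscaleA /rscale.
  by rewrite !scalerDr.
by rewrite bisoVD bisoVR.
Qed.
HB.instance Definition _ h :=
  GRing.isLinear.Build R (right_restr M) I *:%R (D'_x_fun h) (D'_x_linear h).

(* h |-> x h on Hom_R(M, I) *)
Definition D'_x h : {linear right_restr M -> I} := D'_x_fun h.

Fact D'_x_additive : zmod_morphism D'_x.
Proof.
move=> h k; apply/eqP; rewrite eq_sym subr_eq; apply/eqP.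
apply: linear_ext => u; rewrite homDE /= /D'_x_fun.
apply: etrans (bisoVD Psi _ _); congr (bisoV Psi _).
apply: rhom_ext => t /=; set w := rscale _ _.
by rewrite -[LHS]/(h w) -{1}(subrK k h).
Qed.
HB.instance Definition _ := GRing.isZmodMorphism.Build
  {linear right_restr M -> I} {linear right_restr M -> I} D'_x D'_x_additive.

Lemma D'_xZ r h : D'_x (r *: h) = sigma r *: D'_x h.
Proof.
apply: linear_ext => u; rewrite homZE /= /D'_x_fun.
rewrite -[RHS](bisoVL Psi r); congr (bisoV Psi _); exact: rhom_ext.
Qed.
End D'Operator.

(* Hom_R(M, I), with the left action of x given by D'_x; see D'_actX and D'_actC *)
Definition D'_obj (R : comNzRingType) (sigma : {rmorphism R -> R})
    (I : lmodType R) (Psi : frob_dual_iso sigma I)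
    (M : lmodType (skewpoly sigma)^c) : Type :=
  {linear right_restr M -> I}.

Section D'Functor.
Variables (R : comNzRingType) (sigma : {rmorphism R -> R}) (I : lmodType R).
Variable Psi : frob_dual_iso sigma I.
Local Notation S := (skewpoly sigma).
Local Notation D'_obj := (D'_obj Psi).

Section Object.
Variable M : lmodType S^c.
HB.instance Definition _ :=
  GRing.Zmodule.copy (D'_obj M) {linear right_restr M -> I}.

Definition D'_scale (P : S) (h : D'_obj M) : D'_obj M :=
  lop (D'_x Psi (M := M)) P h.
Fact D'_scaleA a b h : D'_scale a (D'_scale b h) = D'_scale (a * b) h.
Proof. exact: esym (lopM (@D'_xZ _ _ _ Psi M) _ _ _). Qed.
Fact D'_scale1 : left_id 1 D'_scale.
Proof. by move=> h; rewrite /D'_scale lopC scale1r. Qed.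
Fact D'_scaleDr : right_distributive D'_scale +%R.
Proof. by move=> a h k; apply: lopDr. Qed.
Fact D'_scaleDl h : {morph D'_scale^~ h : a b / a + b}.
Proof. by move=> a b; apply: lopDl. Qed.
HB.instance Definition _ := GRing.Zmodule_isLmodule.Build S (D'_obj M)
  D'_scaleA D'_scale1 D'_scaleDr D'_scaleDl.

Lemma D'_actX (h : D'_obj M) (u : M) :
  (skewX sigma *: h : {linear right_restr M -> I}) u = bisoV Psi (D'_aux h u).
Proof. by rewrite -[_ *: _]/(lop _ _ _) lopX. Qed.

Lemma D'_actC r (h : D'_obj M) :
  skewC sigma r *: h = r *: (h : {linear right_restr M -> I}).
Proof. exact: lopC. Qed.
End Object.

Section Map.
Variables (M M' : lmodType S^c) (psi : {linear M -> M'}).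

Definition D'_fun (h : D'_obj M') : D'_obj M :=
  ((h : {linear right_restr M' -> I}) \o restr_map (skewCc sigma) psi
    : {linear right_restr M -> I}).

Let D'_funR (h : {linear right_restr M' -> I}) : {linear right_restr M -> I} :=
  D'_fun h.
Let D'_funR_linear : linear D'_funR.
Proof. by move=> r h k; apply: linear_ext. Qed.
HB.instance Definition _ := GRing.isLinear.Build R
  {linear right_restr M' -> I} {linear right_restr M -> I} *:%R
  D'_funR D'_funR_linear.

Fact D'_fun_linear : linear D'_fun.
Proof.
move=> P h k; rewrite -[LHS]/(D'_funR (_ + _)) raddfD; congr (_ + _).
apply: (lop_morph (g := D'_funR)) => {}h; apply: linear_ext => u.
rewrite /= /D'_x_fun; congr (bisoV Psi _); apply: rhom_ext => t /=.
by rewrite /restr_fun /rscale !linearZ.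
Qed.
HB.instance Definition _ := GRing.isLinear.Build S (D'_obj M') (D'_obj M)
  *:%R D'_fun D'_fun_linear.
Definition D'_map : {linear D'_obj M' -> D'_obj M} := D'_fun.
End Map.

Fact D'_map1 (M : lmodType S^c) : D'_map (mod_id M) = mod_id (D'_obj M).
Proof. by apply: linear_ext => m; apply: linear_ext. Qed.
Fact D'_mapM (X Y Z : lmodType S^c) (f : {linear Y -> Z}) (g : {linear X -> Y}) :
  D'_map (mod_comp f g) = mod_comp (D'_map g) (D'_map f).
Proof. by apply: linear_ext => m; apply: linear_ext. Qed.

Definition D'_functor :
    cofunctor (right_module_category S) (module_category S) :=
  @Cofunctor (right_module_category S) (module_category S)
    (fun M : lmodType S^c => D'_obj M : lmodType S) D'_map D'_map1 D'_mapM.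
End D'Functor.

Definition noetherian_module (R : pzRingType) (V : lmodType R) : Prop :=
  forall N : nat -> {pred V},
    (forall n, submod_closed (N n)) ->
    (forall n, {subset N n <= N n.+1}) ->
    exists k, forall n, (k <= n)%N -> N n =i N k.

Definition artinian_module (R : pzRingType) (V : lmodType R) : Prop :=
  forall N : nat -> {pred V},
    (forall n, submod_closed (N n)) ->
    (forall n, {subset N n.+1 <= N n}) ->
    exists k, forall n, (k <= n)%N -> N n =i N k.

Definition noetherian_ring (R : comNzRingType) : Prop := noetherian_module R^o.

(* idealr_closed includes properness *)
Definition maximal_ideal (R : comNzRingType) (m : {pred R}) : Prop :=
  idealr_closed m /\
  forall J : {pred R}, idealr_closed J -> {subset m <= J} -> J =i m.

Definition local_ring (R : comNzRingType) (m : {pred R}) : Prop :=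
  maximal_ideal m /\ forall J : {pred R}, maximal_ideal J -> J =i m.

Definition ideal_mul (R : comNzRingType) (I J : {pred R}) : {pred R} :=
  fun r => `[< exists (n : nat) (a b : 'I_n -> R),
    [/\ forall i, a i \in I, forall i, b i \in J & r = \sum_i a i * b i] >].

Definition ideal_exp (R : comNzRingType) (I : {pred R}) (n : nat) : {pred R} :=
  iter n (ideal_mul I) predT.

(* the canonical map from R to the inverse limit of the R/I^n is bijective *)
Definition adically_complete (R : comNzRingType) (I : {pred R}) : Prop :=
  forall u : nat -> R, (forall n, u n.+1 - u n \in ideal_exp I n) ->
    exists! l, forall n, l - u n \in ideal_exp I n.

Definition finite_rmorphism (A B : comNzRingType) (f : {rmorphism A -> B}) : Prop :=
  exists (n : nat) (b : 'I_n -> B),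
    forall y : B, exists a : 'I_n -> A, y = \sum_i f (a i) * b i.

(* the ring {ideal_quot m}, as an R-module *)
Definition residue (R : comNzRingType) (m : idealr R) : Type := {ideal_quot m}.

Section ResidueModule.
Variables (R : comNzRingType) (m : idealr R).
Local Open Scope quotient_scope.

HB.instance Definition _ := GRing.Zmodule.copy (residue m) {ideal_quot m}.
Definition residue_scale (r : R) (k : residue m) : residue m :=
  \pi_{ideal_quot m} r * (k : {ideal_quot m}).
Fact residue_scaleA a b k :
  residue_scale a (residue_scale b k) = residue_scale (a * b) k.
Proof. by rewrite /residue_scale mulrA rmorphM. Qed.
Fact residue_scale1 : left_id 1 residue_scale.
Proof. by move=> k; rewrite /residue_scale rmorph1 mul1r. Qed.
Fact residue_scaleDr : right_distributive residue_scale +%R.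
Proof. by move=> a k l; rewrite /residue_scale mulrDr. Qed.
Fact residue_scaleDl k : {morph residue_scale^~ k : a b / a + b}.
Proof. by move=> a b; rewrite /residue_scale rmorphD mulrDl. Qed.
HB.instance Definition _ := GRing.Zmodule_isLmodule.Build R (residue m)
  residue_scaleA residue_scale1 residue_scaleDr residue_scaleDl.
End ResidueModule.

Definition injective_module (R : pzRingType) (E : lmodType R) : Prop :=
  forall (U V : lmodType R) (i : {linear U -> V}) (g : {linear U -> E}),
    injective i -> exists h : {linear V -> E}, h \o i =1 g.

Definition essential_embedding (R : pzRingType) (V E : lmodType R)
    (i : {linear V -> E}) : Prop :=
  injective i /\
  forall N : {pred E}, submod_closed N -> (exists2 e, e \in N & e != 0) ->
    exists2 v, i v \in N & i v != 0.

Definition injective_envelope (R : pzRingType) (V E : lmodType R)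
    (i : {linear V -> E}) : Prop :=
  injective_module E /\ essential_embedding i.

Section Frobenius.
Variables (R : comNzRingType) (p : nat) (pcharRp : p \in [pchar R]).

Definition frobenius : {rmorphism R -> R} := pFrobenius_aut pcharRp.
Definition frobenius_skew : nzRingType := skewpoly frobenius.

Definition left_artinian (H : module_category frobenius_skew) : Prop :=
  artinian_module (left_restr H).
Definition left_noetherian (H : module_category frobenius_skew) : Prop :=
  noetherian_module (left_restr H).
Definition right_artinian (M : right_module_category frobenius_skew) : Prop :=
  artinian_module (right_restr M).
Definition right_noetherian (M : right_module_category frobenius_skew) : Prop :=
  noetherian_module (right_restr M).
End Frobenius.

(* Main.v *)
Require Import Defs.
From HB Require Import structures.
From mathcomp Require Import all_boot all_algebra.
From mathcomp Require Import boolp.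

Set Implicit Arguments.
Unset Strict Implicit.
Unset Printing Implicit Defensive.

Import GRing.Theory.
Local Open Scope ring_scope.

(* Matlis duality is reduced to the single fact that every endomorphism of E is
   multiplication by a scalar.  On the elements killed by m^n this follows by Noetherian
   induction on the ideals containing m^n; the scalars obtained for the various n form an
   m-adic Cauchy sequence, and since every element of E is killed by some m^n, their limit
   works on all of E.  Consequently a functional M -> E vanishing on the common kernel of
   h_1, ..., h_n is an R-combination of the h_i (extend it successively over the images
   of the h_i in E), and every functional on Hom(M, E) agrees on finitely many arguments
   with evaluation at a point of M.  This makes Artinian and Noetherian modules reflexive,
   and taking annihilators exchanges the two chain conditions on M and Hom(M, E).
   Finally, evaluation commutes with the action of x because
   Psi(z)(r) = Psi(r z)(1), so the R-isomorphisms M -> M^vv are R[x,f]-linear. *)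

(** * Maximal and minimal members of families of submodules *)

Section ExtremalSubmodules.
Variables (R : pzRingType) (V : lmodType R) (T : Type) (F : T -> {pred V}).
Hypothesis F_submod : forall t, submod_closed (F t).

(** Without a maximal member, choice gives each [F t] a strictly larger [F (f t)], and iterating [f]
    from [t0] yields a chain that never stabilizes. *)
Lemma noetherian_max (t0 : T) : noetherian_module V ->
  exists t, forall t', {subset F t <= F t'} -> {subset F t' <= F t}.
Proof.
move=> noethV; apply: contrapT => no_max.
have /choice[f fP] t : exists t', {subset F t <= F t'} /\ ~ {subset F t' <= F t}.
  apply: contrapT => max_t; apply: no_max; exists t => t' tt'.
  by apply: contrapT => t't; apply: max_t; exists t'.
have [k kP] := noethV (fun n => F (iter n f t0)) (fun n => F_submod _)
  (fun n => (fP (iter n f t0)).1).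
by have [_ []] := fP (iter k f t0); move=> u; rewrite -(kP k.+1).
Qed.

Lemma artinian_min (t0 : T) : artinian_module V ->
  exists t, forall t', {subset F t' <= F t} -> {subset F t <= F t'}.
Proof.
move=> artV; apply: contrapT => no_min.
have /choice[f fP] t : exists t', {subset F t' <= F t} /\ ~ {subset F t <= F t'}.
  apply: contrapT => min_t; apply: no_min; exists t => t' tt'.
  by apply: contrapT => t't; apply: min_t; exists t'.
have [k kP] := artV (fun n => F (iter n f t0)) (fun n => F_submod _)
  (fun n => (fP (iter n f t0)).1).
by have [_ []] := fP (iter k f t0); move=> u; rewrite -(kP k.+1).
Qed.
End ExtremalSubmodules.

(** * Spans and finite generation *)

Section Submodules.
Variables (R : pzRingType) (V : lmodType R).
Implicit Types (N : {pred V}) (s : seq V).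

Lemma submod0 N : submod_closed N -> 0 \in N. Proof. by case. Qed.
Lemma submodP N a u v : submod_closed N -> u \in N -> v \in N -> a *: u + v \in N.
Proof. by case=> _ NP uN vN; apply: NP. Qed.
Lemma submodZ N a u : submod_closed N -> u \in N -> a *: u \in N.
Proof. by move=> NN uN; rewrite -[_ *: _]addr0 submodP ?submod0. Qed.
Lemma submodD N u v : submod_closed N -> u \in N -> v \in N -> u + v \in N.
Proof. by move=> NN uN vN; rewrite -[u]scale1r submodP. Qed.
Lemma submodB N u v : submod_closed N -> u \in N -> v \in N -> u - v \in N.
Proof. by move=> NN uN vN; rewrite addrC -scaleN1r submodP. Qed.

(** This form avoids linear combinations: a property passes to the span once it is seen to cut out a
    submodule containing [s]. *)
Definition lspan s : {pred V} := fun v =>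
  `[< forall N, submod_closed N -> {subset s <= N} -> v \in N >].

Lemma lspan_submod s : submod_closed (lspan s).
Proof.
split=> [|a u v /asboolP us /asboolP vs]; apply/asboolP => N NN sN.
  exact: submod0.
by apply: submodP => //; [apply: us|apply: vs].
Qed.

Lemma mem_lspan s u : u \in s -> u \in lspan s.
Proof. by move=> us; apply/asboolP => N _; apply. Qed.

Lemma noetherian_fg : noetherian_module V -> exists s, forall u, u \in lspan s.
Proof.
move=> /(noetherian_max lspan_submod [::])[s max_s]; exists s => u.
apply: (max_s (u :: s)) => [v /asboolP vs|]; last exact/mem_lspan/mem_head.
by apply: vs (lspan_submod _) _ => w ws; apply: mem_lspan; rewrite inE ws orbT.
Qed.
End Submodules.

(** * Images, preimages and chain conditions along surjections *)

Section Image.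
Variables (R : pzRingType) (V W : lmodType R) (f : {linear V -> W}).

Definition img (N : {pred V}) : {pred W} :=
  fun w => `[< exists2 v, v \in N & w = f v >].

Lemma img_submod N : submod_closed N -> submod_closed (img N).
Proof.
move=> NN; split; first by apply/asboolP; exists 0; rewrite ?submod0 ?raddf0.
move=> a _ _ /asboolP[u uN ->] /asboolP[v vN ->]; apply/asboolP.
by exists (a *: u + v); rewrite ?submodP ?linearP.
Qed.

Lemma preim_submod (N : {pred W}) :
  submod_closed N -> submod_closed [pred v | f v \in N].
Proof.
move=> NN; split=> [|a u v]; rewrite !inE ?raddf0 ?submod0 // => uN vN.
by rewrite linearP submodP.
Qed.

Hypothesis f_surj : forall w, exists v, f v = w.

Lemma noetherian_surj : noetherian_module V -> noetherian_module W.
Proof.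
move=> noethV N NN N_incr.
have [k kP] := noethV (fun n => [pred v | f v \in N n])
  (fun n => preim_submod (NN n)) (fun n v => @N_incr n (f v)).
by exists k => n le_kn w; have [v <-] := f_surj w; apply: kP.
Qed.

Lemma artinian_surj : artinian_module V -> artinian_module W.
Proof.
move=> artV N NN N_decr.
have [k kP] := artV (fun n => [pred v | f v \in N n])
  (fun n => preim_submod (NN n)) (fun n v => @N_decr n (f v)).
by exists k => n le_kn w; have [v <-] := f_surj w; apply: kP.
Qed.
End Image.

Definition linear_of (R : pzRingType) (V W : lmodType R) (f : V -> W)
    (fL : linear f) : {linear V -> W} :=
  HB.pack f (GRing.isLinear.Build R V W *:%R f fL).

(** * Extension of maps into an injective module *)

Section Extension.
Variables (R : pzRingType) (V E : lmodType R) (E_inj : injective_module E).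

Section Subtype.
Variable N : submodClosed V.
Record submodule := Submodule { submodule_val : V; _ : submodule_val \in N }.
HB.instance Definition _ := [isSub for submodule_val].
HB.instance Definition _ := [Choice of submodule by <:].
HB.instance Definition _ := [SubChoice_isSubLmodule of submodule by <:].
End Subtype.

(** Injectivity is applied to the inclusion of [N], made into a subtype. Since [g] is constrained
    only on [N], it may be built by choice with arbitrary values elsewhere. *)
Lemma extend (N : {pred V}) (g : V -> E) : submod_closed N ->
  (forall a, {in N &, forall u v, g (a *: u + v) = a *: g u + g v}) ->
  exists h : {linear V -> E}, {in N, h =1 g}.
Proof.
move=> NN gP.
pose K : submodClosed V := HB.pack N (GRing.isSubmodClosed.Build R V N NN).
have gL : linear (fun u : submodule K => g (val u)).
  by move=> a u v; rewrite linearP gP //; [case: u|case: v].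
have [h hP] := @E_inj _ _ (val : {linear submodule K -> V}) (linear_of gL) val_inj.
by exists h => u uN; have := hP (Submodule (N := K) uN).
Qed.
End Extension.

(** Injectivity and surjectivity of evaluation from [M] to its bidual. *)
Definition matlis_reflexive (R : comPzRingType) (E M : lmodType R) :=
  (forall u : M, (forall h : {linear M -> E}, h u = 0) -> u = 0) /\
  (forall phi : {linear {linear M -> E} -> E}, exists u, forall h, phi h = h u).

(** * Ideals of a Noetherian local ring *)

Section LocalRing.
Variables (R : comNzRingType) (m : idealr R).
Hypotheses (R_noetherian : noetherian_ring R) (R_local : local_ring m).

(** Noetherianity replaces Zorn's lemma: a largest proper ideal above [J] is a maximal ideal, hence
    [m] by locality. *)
Lemma proper_sub_maximal (J : {pred R^o}) :
  submod_closed J -> 1 \notin J -> {subset J <= m}.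
Proof.
move=> JJ J1.
pose T := {K : {pred R^o} | [/\ submod_closed K, 1 \notin K & {subset J <= K}]}.
pose F (t : T) : {pred R^o} := sval t.
have F_submod t : submod_closed (F t) by case: t => K [].
have J_T : [/\ submod_closed J, 1 \notin J & {subset J <= J}] by split.
have [[K [KK K1 JK]] maxK] := noetherian_max F_submod (exist _ J J_T : T) R_noetherian.
suff Km : K =i m by move=> r /JK; rewrite Km.
apply: R_local.2; split=> [|L [L0 L1 LP] KL].
  by split=> [||a u v uK vK]; [exact: submod0 KK|by []|exact: (submodP a KK)].
have L_T : [/\ submod_closed (L : {pred R^o}), 1 \notin L & {subset J <= L}].
  by split=> // r /JK /KL.
by move=> r; apply/idP/idP => [|/KL//]; apply: (maxK (exist _ _ L_T)).
Qed.

Lemma maximal_submod : submod_closed (m : {pred R^o}).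
Proof. by split=> [|a u v um vm]; rewrite ?idealr0 // rpredD ?idealMr. Qed.

Lemma maximal_inv r : r \notin m -> exists s, 1 - s * r \in m.
Proof.
move=> rm; pose J : {pred R^o} := fun y => `[< exists s, y - s * r \in m >].
suff : 1 \in J by move=> /asboolP.
apply/negPn/negP => J1; move/negP: rm; apply; apply: (proper_sub_maximal (J := J)) => //.
  split; first by apply/asboolP; exists 0; rewrite mul0r subr0 idealr0.
  move=> a u v /asboolP[s us] /asboolP[t vt]; apply/asboolP.
  exists (a * s + t); rewrite mulrDl opprD addrACA rpredD //.
  by rewrite -mulrA -mulrBr idealMr.
by apply/asboolP; exists 1; rewrite mul1r subrr idealr0.
Qed.

Lemma ideal_mul_submod (I J : {pred R}) : submod_closed (I : {pred R^o}) ->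
  submod_closed (ideal_mul I J : {pred R^o}).
Proof.
move=> II; split.
  by apply/asboolP; exists 0%N, (fun=> 0), (fun=> 0); split=> [[]|[]|] //; rewrite big_ord0.
move=> c _ _ /asboolP[n [a [b [aI bJ ->]]]] /asboolP[k [a' [b' [a'I b'J ->]]]].
apply/asboolP; exists (n + k)%N.
exists (fun i => match split i with inl i => c * a i | inr i => a' i end).
exists (fun i => match split i with inl i => b i | inr i => b' i end).
split=> [i|i|]; try by case: split.
- by case: split => // j; apply: (@submodZ _ _ (I : {pred R^o})).
rewrite big_split_ord /= [_ *: _]mulr_sumr; congr (_ + _); apply: eq_bigr => i _.
  by rewrite -/(lshift k i) -[lshift k i]/(unsplit (inl i)) unsplitK mulrA.
by rewrite -[rshift n i]/(unsplit (inr i)) unsplitK.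
Qed.

Lemma ideal_exp_submod n : submod_closed (ideal_exp m n : {pred R^o}).
Proof. by case: n => [|n]; [split|apply/ideal_mul_submod/maximal_submod]. Qed.

Lemma mem_ideal_mul (I J : {pred R}) a b : a \in I -> b \in J -> a * b \in ideal_mul I J.
Proof.
by move=> aI bJ; apply/asboolP; exists 1%N, (fun=> a), (fun=> b); rewrite big_ord1.
Qed.

Lemma ideal_mul_sub (I J K : {pred R}) : submod_closed (K : {pred R^o}) ->
  {in I & J, forall a b, a * b \in K} -> {subset ideal_mul I J <= K}.
Proof.
move=> KK IJK r /asboolP[n [a [b [aI bJ ->]]]].
elim/big_ind: _ => [|x y|i _]; [exact: (submod0 KK)|exact: (submodD KK)|exact: IJK].
Qed.

Lemma ideal_expS_sub n : {subset ideal_exp m n.+1 <= ideal_exp m n}.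
Proof.
apply: ideal_mul_sub => [|a b _ bm]; first exact: ideal_exp_submod.
exact: (submodZ a (ideal_exp_submod n)).
Qed.

Lemma ideal_exp_le n k : (n <= k)%N -> {subset ideal_exp m k <= ideal_exp m n}.
Proof.
move=> /subnKC <-; elim: (k - n)%N => [|j IH] r; first by rewrite addn0.
by rewrite addnS => /ideal_expS_sub; apply: IH.
Qed.

(** * The socle of [E] and separation by functionals *)

Section Envelope.
Variables (E : lmodType R) (iota : {linear residue m -> E}).
Hypothesis E_envelope : injective_envelope iota.
Let E_inj : injective_module E := E_envelope.1.

Definition residue1 : residue m := \pi_({ideal_quot m})%qT 1.
Let e1 : E := iota residue1.

Lemma residueE (v : residue m) : exists r, v = r *: residue1.
Proof.
exists (repr (v : {ideal_quot m})%qT).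
rewrite -[LHS](reprK (v : {ideal_quot m})) /residue1.
by rewrite -[_ *: _]/(_ * _) -rmorphM mulr1.
Qed.

Lemma socle_gen_eq0 r : r *: e1 = 0 <-> r \in m.
Proof.
rewrite /e1 -linearZ /=.
have -> : r *: residue1 = (\pi_({ideal_quot m})%qT r : residue m).
  by rewrite -[_ *: _]/(_ * _) -rmorphM mulr1.
have pi0 : (\pi_({ideal_quot m})%qT 0 : residue m) = 0 by exact: rmorph0.
rewrite -(raddf0 iota) -pi0.
have -> : (r \in m) = (\pi_({ideal_quot m})%qT r == \pi_({ideal_quot m})%qT 0 :> {ideal_quot m}).
  by rewrite -Quotient.idealrBE subr0.
by split=> [/E_envelope.2.1 ->//|/eqP ->].
Qed.

Lemma socle_gen_neq0 : e1 <> 0.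
Proof. by rewrite -[e1]scale1r socle_gen_eq0 idealr1. Qed.

(** On [N + R v], sending [w] to [a *: e1] when [w - a *: v] lies in [N] is well defined: the [a]
    with [a *: v] in [N] form a proper ideal, so they lie in [m], which kills [e1]. Injectivity of
    [E] extends this map to [V]. *)
Lemma envelope_cogenerator (V : lmodType R) (N : {pred V}) v : submod_closed N -> v \notin N ->
  exists h : {linear V -> E}, {in N, forall u, h u = 0} /\ h v <> 0.
Proof.
move=> NN vN.
pose I : {pred R^o} := [pred a | a *: v \in N].
have Im : {subset I <= m}.
  apply: proper_sub_maximal; last by rewrite inE scale1r.
  split=> [|a r s]; rewrite !inE ?scale0r ?submod0 // => rN sN.
  by rewrite scalerDl -scalerA submodP.
(* [c w] is an arbitrary admissible coefficient of [w]; by [KP] below, [c w *: e1] does not depend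
   on the choice. *)
have /choice[c cP] w : exists a, (exists a, w - a *: v \in N) -> w - a *: v \in N.
  by case: (pselect (exists a, w - a *: v \in N)) => [[a]|]; [exists a|exists 0].
pose K : {pred V} := fun w => `[< exists a, w - a *: v \in N >].
have KP w a : w - a *: v \in N -> c w *: e1 = a *: e1.
  move=> wN; apply/eqP; rewrite -subr_eq0 -scalerBl; apply/eqP/socle_gen_eq0/Im.
  have /cP cw : exists a, w - a *: v \in N by exists a.
  rewrite inE scalerBl.
  have -> : c w *: v - a *: v = (w - a *: v) - (w - c w *: v).
    by rewrite opprB [RHS]addrC addrA subrK.
  exact: submodB.
have comb a u w s t : u - s *: v \in N -> w - t *: v \in N ->
    (a *: u + w) - (a * s + t) *: v \in N.
  by move=> us wt; rewrite scalerDl opprD addrACA -scalerA -scalerBr submodP.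
have KK : submod_closed K.
  split; first by apply/asboolP; exists 0; rewrite scale0r subr0 submod0.
  move=> a u w /asboolP[s us] /asboolP[t wt].
  by apply/asboolP; exists (a * s + t); apply: comb.
have [|h hP] := extend E_inj (g := fun w => c w *: e1) KK.
  move=> a u w /asboolP[s us] /asboolP[t wt].
  by rewrite (KP _ _ (comb a _ _ _ _ us wt)) (KP _ _ us) (KP _ _ wt) scalerDl scalerA.
exists h; split=> [u uN|].
  have u0 : u - 0 *: v \in N by rewrite scale0r subr0.
  have uK : u \in K by apply/asboolP; exists 0.
  by rewrite hP // (KP _ _ u0) scale0r.
have v1 : v - 1 *: v \in N by rewrite scale1r subrr submod0.
have vK : v \in K by apply/asboolP; exists 1.
by rewrite hP // (KP _ _ v1) scale1r; apply: socle_gen_neq0.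
Qed.

Lemma eq0_by_functionals (V : lmodType R) (v : V) :
  (forall h : {linear V -> E}, h v = 0) -> v = 0.
Proof.
move=> hv0; apply/eqP/negPn/negP => v0.
have [|//|h [_]] := envelope_cogenerator (N := pred1 0) (v := v).
  by split=> [|a u w]; rewrite !inE // => /eqP-> /eqP->; rewrite scaler0 addr0.
by rewrite hv0.
Qed.

(** By essentiality [R e] contains a nonzero [c *: e1]; then [c] is outside [m] and can be inverted
    modulo [m], the annihilator of [e1]. *)
Lemma socle_meet (e : E) : e <> 0 -> exists s, e1 = s *: e.
Proof.
move=> /eqP e0; pose N : {pred E} := fun w => `[< exists s, w = s *: e >].
have NN : submod_closed N.
  split; first by apply/asboolP; exists 0; rewrite scale0r.
  move=> a _ _ /asboolP[s ->] /asboolP[t ->]; apply/asboolP.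
  by exists (a * s + t); rewrite scalerDl scalerA.
have [|v] := E_envelope.2.2 N NN.
  by exists e => //; apply/asboolP; exists 1; rewrite scale1r.
have [c ->] := residueE v; rewrite linearZ => /asboolP[s cs] /eqP c0.
have cm : c \notin m by apply/negP => /socle_gen_eq0.
have [t tm] := maximal_inv cm.
exists (t * s); rewrite -scalerA -cs scalerA -[LHS]scale1r; apply/eqP.
rewrite -subr_eq0 -scalerBl; apply/eqP.
exact/socle_gen_eq0.
Qed.

(** For nonzero [f], [e1 = t *: f] with [t] outside [m] because [m] kills [f]; inverting [t] modulo
    [m] makes [f] a multiple of [e1], hence of [e]. *)
Lemma socle_line (e f : E) : e <> 0 -> (forall r, r \in m -> r *: f = 0) ->
  exists t, f = t *: e.
Proof.
move=> /socle_meet[s es] mf.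
have [->|/eqP f0] := eqVneq f 0; first by exists 0; rewrite scale0r.
have [t ft] := socle_meet f0.
have tm : t \notin m.
  by apply/negP => /mf; rewrite -ft; apply: socle_gen_neq0.
have [u um] := maximal_inv tm.
exists (u * s); rewrite -scalerA -es ft scalerA -[LHS]scale1r; apply/eqP.
by rewrite -subr_eq0 -scalerBl mf.
Qed.

(* Let f have maximal annihilator among the elements not killed by a power of m, and let
   s f be a nonzero multiple of f in the socle.  For a in m, s kills a f but not f, so
   a f is killed by a power of m; by Noetherianity the exponent can be chosen uniformly. *)
Lemma envelope_torsion (e : E) : exists n, {in ideal_exp m n, forall r, r *: e = 0}.
Proof.
apply: contrapT => bad_e.
pose T := {e : E | ~ exists n, {in ideal_exp m n, forall r, r *: e = 0}}.
pose F (t : T) : {pred R^o} := [pred r | r *: sval t == 0].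
have ann_submod (f : E) : submod_closed [pred r : R^o | r *: f == 0].
  split=> [|a u v]; rewrite !inE ?scale0r // => /eqP u0 /eqP v0.
  by rewrite scalerDl -scalerA u0 v0 scaler0 addr0.
have [[f bad_f] max_f] :=
  noetherian_max (F := F) (fun t => ann_submod _) (exist _ e bad_e : T) R_noetherian.
have f0 : f <> 0 by move=> f0; apply: (bad_f); exists 0%N => r _; rewrite f0 scaler0.
have [s es] := socle_meet f0.
pose J n : {pred R^o} := fun y => `[< {in ideal_exp m n, forall r, r *: (y *: f) = 0} >].
have JJ n : submod_closed (J n).
  split; first by apply/asboolP => r _; rewrite scale0r scaler0.
  move=> a u v /asboolP uJ /asboolP vJ; apply/asboolP => r rm.
  by rewrite scalerDl scalerDr -scalerA scalerA mulrC -scalerA uJ ?vJ // scaler0 addr0.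
have J_incr n : {subset J n <= J n.+1}.
  by move=> y /asboolP yJ; apply/asboolP => r rm; apply/yJ/ideal_expS_sub.
have [k kP] := R_noetherian JJ J_incr.
apply: (bad_f); exists k.+1 => r rm.
suff : r \in ([pred r | r *: f == 0] : {pred R^o}) by rewrite inE => /eqP.
apply: (ideal_mul_sub (ann_submod f)) rm => a b am bm; rewrite inE mulrC -scalerA; apply/eqP.
suff /asboolP : a \in J k by apply.
have [n nP] : exists n, {in ideal_exp m n, forall r, r *: (a *: f) = 0}.
  apply: contrapT => bad_af.
  have : s \in F (exist _ f bad_f).
    apply: (max_f (exist _ (a *: f) bad_af)) => [t|]; rewrite !inE /=.
      by move=> /eqP t0; rewrite scalerA mulrC -scalerA t0 scaler0.
    by rewrite scalerA mulrC -scalerA -es; apply/eqP/socle_gen_eq0.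
  by rewrite inE /= -es => /eqP; apply: socle_gen_neq0.
have [nk|/ltnW kn] := leqP n k.
  by apply/asboolP => t /(ideal_exp_le nk); apply: nP.
by rewrite -(kP n kn); apply/asboolP.
Qed.

(** * Endomorphisms of [E] *)

Definition killed (I : {pred R}) (e : E) := {in I, forall a, a *: e = 0}.

(** A functional on [R] vanishing on [I] but not at [a] takes at 1 a value killed by [I] but not by
    [a]. *)
Lemma killed_faithful (I : {pred R^o}) a : submod_closed I ->
  (forall e, killed I e -> a *: e = 0) -> a \in I.
Proof.
move=> II aI; apply/negPn/negP => /(envelope_cogenerator II)[h [hI]]; apply.
rewrite -[a]mulr1 -[a * 1]/(a *: (1 : R^o)) linearZ /= aI // => b bI.
by rewrite -linearZ /= [_ *: _]mulr1 hI.
Qed.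

(* The socle of R/I lifts to some a with m a <= I; subtracting the scalar found for I + Ra,
   phi factors through multiplication by a, whose values lie on the socle line of E. *)
Lemma endo_killed n (I : {pred R^o}) (phi : {linear E -> E}) : submod_closed I ->
  {subset ideal_exp m n <= I} -> exists r, forall e, killed I e -> phi e = r *: e.
Proof.
move=> II mI; apply: contrapT => bad_I.
pose T := {I : {pred R^o} | [/\ submod_closed I, {subset ideal_exp m n <= I} &
  ~ exists r, forall e, killed I e -> phi e = r *: e]}.
have good_I : [/\ submod_closed I, {subset ideal_exp m n <= I} &
  ~ exists r, forall e, killed I e -> phi e = r *: e] by split.
have sval_submod (t : T) : submod_closed (sval t) by case: t => J [].
have [[J [JJ mJ bad_J]] max_J] :=
  noetherian_max sval_submod (exist _ I good_I : T) R_noetherian.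
(* Lower the exponent until [m^k] leaves [J] while [m^(k+1)] is inside, and take [a] in [m^k]
   outside [J]. The descent ends because [m^0] is the whole ring and 1 is not in [J]. *)
have [a aJ am] : exists2 a, a \notin J & forall b, b \in m -> b * a \in J.
  have J1 : 1 \notin J.
    apply/negP => J1; apply: (bad_J); exists 0 => e eJ.
    by rewrite -[e]scale1r eJ // raddf0 scaler0.
  elim: n mJ {good_I T sval_submod max_J mI} => [|k IH] mJ; first by rewrite mJ in J1.
  have [/IH//|] := pselect {subset ideal_exp m k <= J}.
  move=> /existsNP[a /not_implyP[ak /negP aJ]]; exists a => // b bm.
  exact/mJ/mem_ideal_mul.
pose K : {pred R^o} := fun y => `[< exists c, y - c * a \in J >].
have JK : {subset J <= K} by move=> y yJ; apply/asboolP; exists 0; rewrite mul0r subr0.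
have KK : submod_closed K.
  split; first exact/JK/submod0.
  move=> d u v /asboolP[s us] /asboolP[t vt]; apply/asboolP; exists (d * s + t).
  rewrite mulrDl opprD addrACA -mulrA -mulrBr; exact: (submodP d JJ us vt).
have aK : a \in K by apply/asboolP; exists 1; rewrite mul1r subrr; apply: submod0.
have [r rP] : exists r, forall e, killed K e -> phi e = r *: e.
  apply: contrapT => bad_K.
  have good_K : [/\ submod_closed K, {subset ideal_exp m n <= K} &
    ~ exists r, forall e, killed K e -> phi e = r *: e].
    by split=> // y /mJ /JK.
  by move/negP: aJ; apply; apply: (max_J (exist _ K good_K)).
have {}rP e : killed J e -> a *: e = 0 -> phi e - r *: e = 0.
  move=> eJ ae; rewrite rP ?subrr // => y /asboolP[c yc].
  by rewrite -[y](subrK (c * a)) scalerDl eJ // -scalerA ae scaler0 addr0.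
apply: (bad_J).
have [[e0 [e0J ae0]]|] := pselect (exists e, killed J e /\ a *: e <> 0); last first.
  move=> no_e; exists r => e eJ; apply/eqP; rewrite -subr_eq0 rP //.
  by apply: contrapT => ae; apply: no_e; exists e.
pose psi : {linear E -> E} := phi - r *: mod_id E.
have killedZ c e : killed J e -> killed J (c *: e).
  by move=> eJ y yJ; rewrite scalerA mulrC -scalerA eJ // scaler0.
have line e : killed J e -> exists t, a *: e = t *: (a *: e0).
  by move=> eJ; apply: socle_line => // b bm; rewrite scalerA eJ ?am.
(* For [b] in [m], [b * a] lies in [J], so [a] kills [b *: e0] and [psi] vanishes there; thus [m]
   kills [psi e0]. *)
have [|s sP] := @socle_line (a *: e0) (psi e0) ae0.
  move=> b bm; rewrite -linearZ; apply: rP; first exact: killedZ.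
  by rewrite scalerA mulrC e0J ?am.
(* Since [a *: e = t *: (a *: e0)], the element [e - t *: e0] is killed by [J] and [a], so
   [psi e = t *: psi e0 = s *: (a *: e)]. *)
exists (r + s * a) => e eJ; have [t tP] := line e eJ.
apply/eqP; rewrite scalerDl addrC -subr_eq; apply/eqP.
rewrite -[LHS]/(psi e) -scalerA tP (scalerA s t) [s * t]mulrC -scalerA -sP -linearZ.
apply/eqP; rewrite -subr_eq0; apply/eqP.
rewrite -[LHS]/(psi e - psi (t *: e0)) -raddfB; apply: rP.
  move=> y yJ; rewrite scalerBr scalerA mulrC -scalerA eJ // e0J //.
  by rewrite scaler0 subr0.
by rewrite scalerBr tP !scalerA mulrC subrr.
Qed.

Hypothesis R_complete : adically_complete m.

Lemma endo_scalar (phi : {linear E -> E}) : exists r, forall e, phi e = r *: e.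
Proof.
have /choice[u uP] n := endo_killed phi (ideal_exp_submod n) (fun=> id).
have [|l [lP _]] := R_complete (u := u).
  move=> n; apply: (killed_faithful (ideal_exp_submod n)) => e en.
  rewrite scalerBl -!uP ?subrr // => r rm.
  exact/en/ideal_expS_sub.
exists l => e; have [n en] := envelope_torsion e.
by rewrite (uP n) //; apply/eqP; rewrite eq_sym -subr_eq0 -scalerBl en.
Qed.

(** * Common kernels and finite interpolation *)

Section Dual.
Variable M : lmodType R.
Implicit Types (hs : seq {linear M -> E}) (h k : {linear M -> E}) (u : M).

Definition common_ker hs : {pred M} := [pred u | all (fun h => h u == 0) hs].

Lemma common_ker_submod hs : submod_closed (common_ker hs).
Proof.
split=> [|a u v]; first by apply/allP => h _; rewrite raddf0.
move=> /allP uhs /allP vhs; apply/allP => h hhs.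
by rewrite linearP (eqP (uhs h hhs)) (eqP (vhs h hhs)) scaler0 addr0.
Qed.

(** Induction: on the common kernel of [hs], [h] vanishes where [k] does, so it factors through [k].
    The factor extends to an endomorphism of [E], a scalar [r], and the induction hypothesis applies
    to [h - r *: k]. *)
Lemma lspan_common_ker hs h : {in common_ker hs, forall u, h u = 0} -> h \in lspan hs.
Proof.
elim: hs h => [|k hs IH] h h0.
  have -> : h = 0 by apply: linear_ext => u; apply: h0.
  exact/submod0/lspan_submod.
have /choice[c cP] e : exists u, e \in img k (common_ker hs) ->
    u \in common_ker hs /\ k u = e.
  have [/asboolP[u uK ->]|_] := boolP (e \in _); first by exists u.
  by exists 0.
have h_fact u v : u \in common_ker hs -> v \in common_ker hs -> k u = k v -> h u = h v.
  move=> uK vK kuv; apply/eqP; rewrite -subr_eq0 -raddfB; apply/eqP/h0.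
  rewrite inE /= raddfB /= kuv subrr eqxx /=.
  exact: (submodB (common_ker_submod hs)).
have KK := img_submod k (common_ker_submod hs).
have [|phi phiP] := extend E_envelope.1 (g := fun e => h (c e)) KK.
  move=> a e f eK fK; rewrite -linearP; apply: h_fact.
  - by apply: (cP _ _).1; apply: submodP.
  - by apply: submodP (common_ker_submod hs) (cP _ eK).1 (cP _ fK).1.
  by rewrite linearP (cP _ eK).2 (cP _ fK).2 (cP _ (submodP a KK eK fK)).2.
have [r rP] := endo_scalar phi.
have hk : h - r *: k \in lspan hs.
  apply: IH => u uK; have kuK : k u \in img k (common_ker hs) by apply/asboolP; exists u.
  rewrite -[LHS]/(h u - r *: k u) -rP phiP //.
  by rewrite (h_fact _ u (cP _ kuK).1 uK) ?subrr // (cP _ kuK).2.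
rewrite -[h](subrK (r *: k)); apply: submodD; first exact: lspan_submod.
  move/asboolP: hk; apply; first exact: lspan_submod.
  by move=> f fhs; apply: mem_lspan; rewrite inE fhs orbT.
by apply: submodZ; [exact: lspan_submod|apply/mem_lspan/mem_head].
Qed.

Variable phi : {linear {linear M -> E} -> E}.

Lemma agree_submod u : submod_closed [pred h | phi h == h u].
Proof.
split=> [|a h k]; rewrite !inE ?raddf0 // => /eqP hu /eqP ku.
by rewrite linearP hu ku.
Qed.

Lemma lspan_agree hs u : {in hs, forall h, phi h = h u} -> {in lspan hs, forall h, phi h = h u}.
Proof.
move=> hsu h /asboolP/(_ _ (agree_submod u)) hP; apply/eqP/hP => k khs.
by rewrite inE hsu.
Qed.

(** Induction: correct [u] by some [v] in the common kernel of [hs] with [k v = phi k - k u]. If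
    there is none, some endomorphism of [E], a scalar [r], kills the image of that kernel but not
    [phi k - k u]; then [r *: k] lies in the span of [hs], where [phi] is evaluation at [u], a
    contradiction. *)
Lemma interpolate hs : exists u, {in hs, forall h, phi h = h u}.
Proof.
elim: hs => [|k hs [u uP]]; first by exists 0.
have [] := boolP (phi k - k u \in img k (common_ker hs)).
  move=> /asboolP[v vK kv]; exists (u + v) => h; rewrite inE => /predU1P[->|hhs].
    by rewrite raddfD /= -kv addrC subrK.
  by rewrite raddfD /= uP // (eqP (allP vK h hhs)) addr0.
move=> /(envelope_cogenerator (img_submod k (common_ker_submod hs)))[psi [psi0]].
have [r rP] := endo_scalar psi.
have /(lspan_agree uP) : r *: k \in lspan hs.
  by apply: lspan_common_ker => v vK; rewrite homZE -rP psi0 //; apply/asboolP; exists v.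
by rewrite linearZ /= rP scalerBr => ->; rewrite subrr.
Qed.
End Dual.

(** For [hs] with minimal common kernel, every [h] vanishes on that kernel and so lies in the span
    of [hs]; a point interpolating [phi] on [hs] then serves for all [h]. *)
Lemma artinian_reflexive (M : lmodType R) : artinian_module M -> matlis_reflexive E M.
Proof.
move=> artM; split=> [u|phi]; first exact: eq0_by_functionals.
have [hs hsP] := artinian_min (@common_ker_submod M) [::] artM.
have [u uP] := interpolate phi hs; exists u => h.
apply: (lspan_agree uP); apply: lspan_common_ker => v.
by move=> vK; have /andP[/eqP] := hsP (h :: hs) (fun w wK => (andP wK).2) v vK.
Qed.

Definition eval_fun (M : lmodType R) (u : M) (h : {linear M -> E}) : E := h u.

Lemma eval_linear (M : lmodType R) (u : M) : linear (eval_fun u).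
Proof. by []. Qed.

(** Evaluations at finitely many generators have zero common kernel in the dual, so
    [lspan_common_ker], applied to the dual in place of [M], puts [phi] in their span; and
    evaluations form a submodule. *)
Lemma noetherian_reflexive (M : lmodType R) : noetherian_module M -> matlis_reflexive E M.
Proof.
move=> noethM; split=> [u|phi]; first exact: eq0_by_functionals.
have [s sP] := noetherian_fg noethM.
pose ev u : {linear {linear M -> E} -> E} := linear_of (@eval_linear M u).
have : phi \in lspan [seq ev u | u <- s].
  apply: lspan_common_ker => h /allP hs0.
  suff -> : h = 0 by rewrite raddf0.
  apply: linear_ext => u; have /asboolP uP := sP u; apply/eqP.
  apply: (uP [pred u | h u == 0]) => [|v vs].
    split=> [|a v w]; rewrite !inE ?raddf0 // => /eqP v0 /eqP w0.
    by rewrite linearP v0 w0 scaler0 addr0.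
  exact/(hs0 (ev v))/map_f.
move=> /asboolP phiP.
pose X : {pred {linear {linear M -> E} -> E}} := fun psi => `[< exists u, psi = ev u >].
have XX : submod_closed X.
  split; first by apply/asboolP; exists 0; apply: linear_ext => h; rewrite /= /eval_fun raddf0.
  move=> a _ _ /asboolP[u ->] /asboolP[v ->]; apply/asboolP; exists (a *: u + v).
  by apply: linear_ext => h; rewrite /= /eval_fun linearP.
have /asboolP[u ->] : phi \in X; last by exists u.
by apply: phiP => // _ /mapP[u _ ->]; apply/asboolP; exists u.
Qed.

(** * Annihilators and chain conditions on the dual *)

Section Annihilators.
Variables (M : lmodType R) (M_refl : matlis_reflexive E M).

Definition annihilator (X : {pred {linear M -> E}}) : {pred M} :=
  fun u => `[< forall h : {linear M -> E}, h \in X -> h u = 0 >].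

Lemma annihilator_submod X : submod_closed (annihilator X).
Proof.
split=> [|a u v /asboolP uX /asboolP vX]; apply/asboolP => h hX; rewrite ?raddf0 //.
by rewrite linearP uX ?vX // scaler0 addr0.
Qed.

Lemma annihilatorS (X Y : {pred {linear M -> E}}) :
  {subset X <= Y} -> {subset annihilator Y <= annihilator X}.
Proof. by move=> XY u /asboolP uY; apply/asboolP => h /XY; apply: uY. Qed.

(** A functional on the dual separating [h] from [X] is, by reflexivity, evaluation at a point,
    which then lies in the annihilator of [X]. *)
Lemma annihilatorK X (h : {linear M -> E}) : submod_closed X ->
  {in annihilator X, forall u, h u = 0} -> h \in X.
Proof.
move=> XX hX; apply/negPn/negP => /(envelope_cogenerator XX)[phi [phi0]]; apply.
have [u uP] := M_refl.2 phi; rewrite uP hX //.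
by apply/asboolP => k kX; rewrite -uP phi0.
Qed.

Lemma annihilator_sub (X Y : {pred {linear M -> E}}) : submod_closed Y ->
  {subset annihilator Y <= annihilator X} -> {subset X <= Y}.
Proof.
by move=> YY YX h hX; apply: annihilatorK => // u /YX /asboolP; apply.
Qed.

Lemma dual_noetherian : artinian_module M -> noetherian_module {linear M -> E}.
Proof.
move=> artM X XX X_incr.
have [k kP] := artM _ (fun n => annihilator_submod (X n))
  (fun n => annihilatorS (@X_incr n)).
by exists k => n /kP Xnk h; apply/idP/idP; apply: annihilator_sub => // u; rewrite Xnk.
Qed.

Lemma dual_artinian : noetherian_module M -> artinian_module {linear M -> E}.
Proof.
move=> noethM X XX X_decr.
have [k kP] := noethM _ (fun n => annihilator_submod (X n))
  (fun n => annihilatorS (@X_decr n)).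
by exists k => n /kP Xnk h; apply/idP/idP; apply: annihilator_sub => // u; rewrite Xnk.
Qed.
End Annihilators.
End Envelope.
End LocalRing.

Lemma bijective_isom (S : pzRingType) (U V : lmodType S) (f : {linear U -> V}) :
  (forall u, f u = 0 -> u = 0) -> (forall v, exists u, f u = v) ->
  isom (C := module_category S) f.
Proof.
move=> f_inj /choice[g fgK].
have gfK u : g (f u) = u.
  by apply/eqP; rewrite -subr_eq0; apply/eqP/f_inj; rewrite raddfB /= fgK subrr.
have gL : linear g by move=> a u v; rewrite -{1}[u]fgK -{1}[v]fgK -linearP gfK.
by exists (linear_of gL); split; apply: linear_ext => u /=.
Qed.

(** * Skew polynomial modules as modules with an operator *)

Section SkewPolynomialAction.
Variables (R : comNzRingType) (sigma : {rmorphism R -> R}).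
Local Notation S := (skewpoly sigma).

Section Left.
Variable H : lmodType S.

Definition left_X (h : left_restr H) : left_restr H := skewX sigma *: (h : H).
Fact left_X_additive : zmod_morphism left_X.
Proof. by move=> u v; rewrite /left_X scalerBr. Qed.
HB.instance Definition _ := GRing.isZmodMorphism.Build
  (left_restr H) (left_restr H) left_X left_X_additive.

(** With [lop_morph], this reduces linearity over the skew polynomial ring to [R]-linearity and
    commutation with [x]. *)
Lemma left_lopE (P : S) (h : H) : P *: h = lop left_X P h.
Proof.
rewrite {1}(skewpolyE P) scaler_suml; apply: eq_bigr => i _.
rewrite -scalerA; congr (_ *: _); elim: (i : nat) => [|j IH]; first by rewrite scale1r.
by rewrite exprS -scalerA IH.
Qed.
End Left.

Section Right.
Variable M : lmodType S^c.

Definition right_X (u : right_restr M) : right_restr M := rscale (u : M) (skewX sigma).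
Fact right_X_additive : zmod_morphism right_X.
Proof. by move=> u v; rewrite /right_X /rscale scalerBr. Qed.
HB.instance Definition _ := GRing.isZmodMorphism.Build
  (right_restr M) (right_restr M) right_X right_X_additive.

Lemma right_ropE (P : S) (u : M) : rscale u P = rop right_X P u.
Proof.
rewrite /rscale {1}(skewpolyE P) scaler_suml; apply: eq_bigr => i _.
rewrite -/(rscale u _) -rscaleA.
rewrite -[_ *: (u : right_restr M)]/(rscale u (skewC sigma (P : {poly R})`_i)).
move: (rscale u _) => v.
elim: (i : nat) => [|j IH]; first exact: scale1r.
by rewrite exprSr -rscaleA IH.
Qed.
End Right.
End SkewPolynomialAction.

(** * Evaluation as a natural isomorphism of skew polynomial modules *)

Section Biduality.
Variables (R : comNzRingType) (sigma : {rmorphism R -> R}) (I : lmodType R).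
Variable Psi : frob_dual_iso sigma I.
Local Notation S := (skewpoly sigma).

Section Left.
Variable H : lmodType S.
Local Notation DH := (D_obj Psi H).

Definition left_eval_at (h : left_restr H) (f : right_restr DH) : I :=
  (f : {linear left_restr H -> I}) h.
Fact left_eval_at_linear h : linear (left_eval_at h).
Proof.
move=> r f g; rewrite -[r *: f]/(rscale (f : DH) (skewC sigma r)).
by rewrite [rscale _ _]D_actC.
Qed.
HB.instance Definition _ h := GRing.isLinear.Build R (right_restr DH) I *:%R
  (left_eval_at h) (left_eval_at_linear h).

Definition left_eval_R (h : left_restr H) : {linear right_restr DH -> I} :=
  left_eval_at h.
Fact left_eval_R_linear : linear left_eval_R.
Proof. by move=> r u v; apply: linear_ext => f; rewrite /= /left_eval_at linearP. Qed.
HB.instance Definition _ := GRing.isLinear.Build R (left_restr H)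
  {linear right_restr DH -> I} *:%R left_eval_R left_eval_R_linear.

Lemma left_eval_X h : left_eval_R (left_X h) = D'_x Psi (left_eval_R h).
Proof.
apply: linear_ext => f; rewrite /= /D'_x_fun.
(* After applying [Psi], the claim is [Psi z r = Psi (r *: z) 1] for [z] the value of [f] at [x h]:
   right linearity of [Psi]. *)
apply: (can_inj (bisoK Psi)); rewrite bisoVK; apply: rhom_ext => r.
rewrite /= /left_eval_at D_actX D_actC homZE.
by rewrite -[r *: _]/(ract (_ : left_twist sigma I) r) bisoR /= mulr1.
Qed.

Definition left_eval_fun (h : H) : D'_obj Psi DH := left_eval_R h.
Fact left_eval_linear : linear left_eval_fun.
Proof.
move=> P u v; rewrite /left_eval_fun raddfD; congr (_ + _).
by rewrite left_lopE [LHS](lop_morph left_eval_X).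
Qed.
HB.instance Definition _ := GRing.isLinear.Build S H (D'_obj Psi DH) *:%R
  left_eval_fun left_eval_linear.
Definition left_eval : {linear H -> D'_obj Psi DH} := left_eval_fun.

(* The R-module structures of {linear left_restr H -> I} and right_restr DH agree only
   propositionally, by D_actC. *)
Definition dual_D (f : {linear left_restr H -> I}) : right_restr DH := f.
Fact dual_D_linear : linear dual_D.
Proof.
move=> r f g; rewrite -[r *: dual_D f]/(rscale (f : DH) (skewC sigma r)).
by rewrite [rscale _ _]D_actC.
Qed.
HB.instance Definition _ := GRing.isLinear.Build R {linear left_restr H -> I}
  (right_restr DH) *:%R dual_D dual_D_linear.

Lemma left_eval_isom : matlis_reflexive I (left_restr H) ->
  isom (C := module_category S) left_eval.
Proof.
move=> [H_inj H_surj]; apply: bijective_isom => [h h0|phi].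
  apply: H_inj => f; rewrite -[LHS]/((left_eval h : {linear right_restr DH -> I}) f).
  by rewrite h0.
have [h hP] := H_surj ((phi : {linear right_restr DH -> I}) \o dual_D).
by exists h; apply: linear_ext => f; apply: esym (hP f).
Qed.
End Left.

Section Right.
Variable M : lmodType S^c.
Local Notation DM := (D'_obj Psi M).

Definition right_eval_at (u : right_restr M) (f : left_restr DM) : I :=
  (f : {linear right_restr M -> I}) u.
Fact right_eval_at_linear u : linear (right_eval_at u).
Proof.
move=> r f g; rewrite -[r *: f]/(skewC sigma r *: (f : DM)).
by rewrite [skewC _ _ *: _]D'_actC.
Qed.
HB.instance Definition _ u := GRing.isLinear.Build R (left_restr DM) I *:%R
  (right_eval_at u) (right_eval_at_linear u).

Definition right_eval_R (u : right_restr M) : {linear left_restr DM -> I} :=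
  right_eval_at u.
Fact right_eval_R_linear : linear right_eval_R.
Proof. by move=> r u v; apply: linear_ext => f; rewrite /= /right_eval_at linearP. Qed.
HB.instance Definition _ := GRing.isLinear.Build R (right_restr M)
  {linear left_restr DM -> I} *:%R right_eval_R right_eval_R_linear.

Lemma right_eval_X u : right_eval_R (right_X u) = D_x Psi (right_eval_R u).
Proof.
apply: linear_ext => f; rewrite /= /D_x_fun /= /right_eval_at D'_actX bisoVK /=.
(* [Psi] and its inverse have cancelled, leaving [u x = (u 1) x]. *)
by congr (_ (right_X _)); rewrite rmorph1 [RHS]scale1r.
Qed.

Definition right_eval_fun (u : M) : D_obj Psi DM := right_eval_R u.
Fact right_eval_linear : linear right_eval_fun.
Proof.
move=> P u v; rewrite /right_eval_fun raddfD; congr (_ + _).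
by rewrite -/(rscale u P) right_ropE [LHS](rop_morph right_eval_X).
Qed.
HB.instance Definition _ := GRing.isLinear.Build S^c M (D_obj Psi DM) *:%R
  right_eval_fun right_eval_linear.
Definition right_eval : {linear M -> D_obj Psi DM} := right_eval_fun.

Definition dual_D' (f : {linear right_restr M -> I}) : left_restr DM := f.
Fact dual_D'_linear : linear dual_D'.
Proof.
move=> r f g; rewrite -[r *: dual_D' f]/(skewC sigma r *: (f : DM)).
by rewrite [skewC _ _ *: _]D'_actC.
Qed.
HB.instance Definition _ := GRing.isLinear.Build R {linear right_restr M -> I}
  (left_restr DM) *:%R dual_D' dual_D'_linear.

Lemma right_eval_isom : matlis_reflexive I (right_restr M) ->
  isom (C := right_module_category S) right_eval.
Proof.
move=> [M_inj M_surj]; apply: bijective_isom => [u u0|phi].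
  apply: M_inj => f; rewrite -[LHS]/((right_eval u : {linear left_restr DM -> I}) f).
  by rewrite u0.
have [u uP] := M_surj ((phi : {linear left_restr DM -> I}) \o dual_D').
by exists u; apply: linear_ext => f; apply: esym (uP f).
Qed.
End Right.

Variables (P : module_category S -> Prop) (Q : right_module_category S -> Prop).
Hypotheses (P_refl : forall H : lmodType S, P H -> matlis_reflexive I (left_restr H))
  (Q_refl : forall M : lmodType S^c, Q M -> matlis_reflexive I (right_restr M)).
Hypotheses (PQ : forall H, P H -> Q (D_functor Psi H))
  (QP : forall M, Q M -> P (D'_functor Psi M)).

Lemma left_comp_iso_id :
  comp_iso_id (cofunctor_restr PQ) (cofunctor_restr QP).
Proof.
exists (fun H => left_eval (sval H)); split=> [[H PH]|[H PH] [H' PH'] f].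
  exact: left_eval_isom (P_refl PH).
(* Both sides of the naturality square send [h] to the map [g |-> g (f h)], by computation. *)
by apply: linear_ext => h; apply: linear_ext.
Qed.

Lemma right_comp_iso_id :
  comp_iso_id (cofunctor_restr QP) (cofunctor_restr PQ).
Proof.
exists (fun M => right_eval (sval M)); split=> [[M QM]|[M QM] [M' QM'] f].
  exact: right_eval_isom (Q_refl QM).
by apply: linear_ext => u; apply: linear_ext.
Qed.
End Biduality.

Theorem corollary1p21 (R : comNzRingType) (p : nat) (pcharRp : p \in [pchar R])
    (m : idealr R) (E : lmodType R) (iota : {linear residue m -> E})
    (R_noetherian : noetherian_ring R)
    (R_local : local_ring m)
    (R_complete : adically_complete m)
    (R_F_finite : finite_rmorphism (frobenius pcharRp))
    (E_envelope : injective_envelope iota)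
    (Psi : frob_dual_iso (frobenius pcharRp) E) :
  inverse_dualities_on
    (@left_artinian R p pcharRp) (@right_noetherian R p pcharRp)
    (D_functor Psi) (D'_functor Psi) /\
  inverse_dualities_on
    (@right_artinian R p pcharRp) (@left_noetherian R p pcharRp)
    (D'_functor Psi) (D_functor Psi).
Proof.
have art_refl := artinian_reflexive R_noetherian R_local E_envelope R_complete.
have noeth_refl := noetherian_reflexive R_noetherian R_local E_envelope R_complete.
have dual_noeth := dual_noetherian R_noetherian R_local E_envelope.
have dual_art := dual_artinian R_noetherian R_local E_envelope.
(* [dual_D] is the identity on elements; being onto, it carries chain conditions from the [R]-dual
   of [H] to the restriction of [D_obj Psi H]. *)
have D_surj (H : lmodType (frobenius_skew pcharRp)) f : exists g, @dual_D _ _ _ Psi H g = f.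
  by exists f.
have D'_surj (M : lmodType (frobenius_skew pcharRp)^c) f :
  exists g, @dual_D' _ _ _ Psi M g = f by exists f.
split.
  have PQ (H : module_category (frobenius_skew pcharRp)) :
      left_artinian H -> right_noetherian (D_functor Psi H).
    move=> artH; apply: noetherian_surj (D_surj H) _.
    exact: dual_noeth (art_refl _ artH) artH.
  have QP (M : right_module_category (frobenius_skew pcharRp)) :
      right_noetherian M -> left_artinian (D'_functor Psi M).
    move=> noethM; apply: artinian_surj (D'_surj M) _.
    exact: dual_art (noeth_refl _ noethM) noethM.
  exists PQ, QP; split.
    exact: left_comp_iso_id (fun H => @art_refl (left_restr H)) PQ QP.
  exact: right_comp_iso_id (fun M => @noeth_refl (right_restr M)) PQ QP.
have PQ (M : right_module_category (frobenius_skew pcharRp)) :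
    right_artinian M -> left_noetherian (D'_functor Psi M).
  move=> artM; apply: noetherian_surj (D'_surj M) _.
  exact: dual_noeth (art_refl _ artM) artM.
have QP (H : module_category (frobenius_skew pcharRp)) :
    left_noetherian H -> right_artinian (D_functor Psi H).
  move=> noethH; apply: artinian_surj (D_surj H) _.
  exact: dual_art (noeth_refl _ noethH) noethH.
exists PQ, QP; split.
  exact: right_comp_iso_id (fun M => @art_refl (right_restr M)) QP PQ.
exact: left_comp_iso_id (fun H => @noeth_refl (left_restr H)) QP PQ.
Qed.
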